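(* Let $W\subseteq V=\mathbb{C}^E$ be a configuration whose matroid $\mathsf{M}=\mathsf{M}_W$ has no loops or coloops. Then $\operatorname{trop}(\Lambda_W^\circ)=|\Delta_{\mathsf{M}}|$ with all weights equal to $1$.
   Context: Configurations. $E=\{1,\dots,n\}$, $V=\mathbb{C}^E$ has basis $x_1,\dots,x_n$, and $V^\star$ has the dual basis $y_1,\dots,y_n$. For $v\in V$ put $v_i=y_i(v)$; for $\beta\in V^\star$ put $\beta_i=\beta(x_i)$. A configuration is a linear subspace $W\subseteq V$; $r=\dim W$, and it is assumed that $n>r>0$. Its matroid $\mathsf{M}_W$ on $E$ has as bases those $B\subseteq E$ for which the coordinate projection $W\to\mathbb{C}^B$ is an isomorphism; $\mathsf{M}^\perp$ is the dual matroid. Put $\ell_i=y_i|_W$. $\Lambda_W\subseteq\mathbb{P}W\times\mathbb{P}V^\star\subseteq\mathbb{P}V\times\mathbb{P}V^\star$ (spaces of lines) is the subscheme of pairs $(w,\beta)$ defined by $\sum_{i\in E}\beta_iw_i\ell_i=0$ in $W^\star$. $\mathbb{T}_E\subseteq\mathbb{P}V$ and $\mathbb{T}_{E^\star}\subseteq\mathbb{P}V^\star$ are the tori where all coordinates are nonzero, and $\Lambda_W^\circ=\Lambda_W\cap(\mathbb{T}_E\times\mathbb{T}_{E^\star})$. Tropicalization is with respect to the trivial valuation on $\mathbb{C}$ (min convention), with its multiplicities as weights, and lies in the real cocharacter space of the torus. $N_E=\mathbb{R}^E/\mathbb{R}e_E$ with lattice $\mathbb{Z}^E/\mathbb{Z}e_E$,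 where $e_S=\sum_{i\in S}e_i$, is the cocharacter space of $\mathbb{T}_E$. The cocharacter lattice of $\mathbb{T}_{E^\star}$, with unit vectors $e_i^\star$, is identified with that of $\mathbb{T}_E$ by $e_i^\star=-e_i$. $N_{E,E}=N_E\oplus N_E$ is the resulting cocharacter space of $\mathbb{T}_E\times\mathbb{T}_{E^\star}$. For a loopless matroid $\mathsf{M}$ on $E$, the Bergman fan $\Sigma_{\mathsf{M}}$ in $N_E$ has cones spanned by $e_{F_1},\dots,e_{F_k}$ for chains $\emptyset\subsetneq F_1\subsetneq\cdots\subsetneq F_k\subsetneq E$ of flats of $\mathsf{M}$. Let $\mu\colon N_{E,E}\to N_{E,E}$, $\mu(x,y)=(x,x+y)$, and $\Delta_{\mathsf{M}}=-\mu((-\Sigma_{\mathsf{M}})\times\Sigma_{\mathsf{M}^\perp})$. $|\cdot|$ denotes the support of a fan. *)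

(* Defs.v *)
From HB Require Import structures.
From mathcomp Require Import all_boot all_order all_algebra.
From mathcomp Require Import finmap monalg complex.
From mathcomp Require Import boolp classical_sets functions reals.
From mathcomp Require Import topology normedtype.

Set Implicit Arguments.
Unset Strict Implicit.
Unset Printing Implicit Defensive.

Import Order.TTheory GRing.Theory Num.Theory.
Import numFieldNormedType.Exports.

Local Open Scope classical_set_scope.
Local Open Scope ring_scope.

(* ---------------------------------------------------------------------- *)
(* Group algebras.  The ring structure that monalg puts on {malg K[M]}      *)
(* needs a monoid M without nontrivial units, hence the alias below.        *)

Definition groupalg (K : comNzRingType) (M : zmodType) : Type := {malg K[M]}.

Section GroupAlgebra.
Variables (K : comNzRingType) (M : zmodType).

HB.instance Definition _ := GRing.Zmodule.on (groupalg K M).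

Implicit Types f g h : groupalg K M.

Definition ga_mul f g : groupalg K M :=
  \sum_(a <- msupp f) \sum_(b <- msupp g) << f@_a * g@_b *g a + b >>.

Definition ga_one : groupalg K M := << 1 *g 0 >>.

Lemma ga_mulw (d1 d2 : {fset M}) f g :
  (msupp f `<=` d1)%fset -> (msupp g `<=` d2)%fset ->
  ga_mul f g = \sum_(a <- d1) \sum_(b <- d2) << f@_a * g@_b *g a + b >>.
Proof.
move=> le_d1 le_d2; rewrite /ga_mul (big_fset_incl _ le_d1) /=.
  apply: eq_bigr => a _; apply/big_fset_incl => // b _ /mcoeff_outdom ->.
  by rewrite mulr0 monalgU0.
move=> a _ /mcoeff_outdom fa.
by rewrite big1 // => b _; rewrite fa mul0r monalgU0.
Qed.

Lemma ga_mulC : commutative ga_mul.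
Proof.
move=> f g; rewrite /ga_mul exchange_big /=.
by apply: eq_bigr => a _; apply: eq_bigr => b _; rewrite mulrC addrC.
Qed.

Lemma ga_mulDl : left_distributive ga_mul +%R.
Proof.
move=> f g h.
rewrite (ga_mulw (msuppD_le f g) (fsubset_refl (msupp h))).
rewrite (ga_mulw (fsubsetUl (msupp f) (msupp g)) (fsubset_refl (msupp h))).
rewrite (ga_mulw (fsubsetUr (msupp f) (msupp g)) (fsubset_refl (msupp h))).
rewrite -big_split /=; apply: eq_bigr => a _.
rewrite -big_split /=; apply: eq_bigr => b _.
by rewrite mcoeffD mulrDl monalgUD.
Qed.

Lemma ga_mulDr : right_distributive ga_mul +%R.
Proof. by move=> f g h; rewrite ga_mulC ga_mulDl !(ga_mulC _ f). Qed.

Lemma ga_mul0 : left_zero 0 ga_mul.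
Proof. by move=> f; rewrite /ga_mul msupp0 big_seq_fset0. Qed.

Lemma ga_mulr0 : right_zero 0 ga_mul.
Proof. by move=> f; rewrite ga_mulC ga_mul0. Qed.

Lemma ga_mulUU (c d : K) (a b : M) :
  ga_mul << c *g a >> << d *g b >> = << c * d *g a + b >>.
Proof. by rewrite (ga_mulw msuppU_le msuppU_le) !big_seq_fset1 !mcoeffUU. Qed.

Lemma ga_mul_suml (I : Type) (s : seq I) (F : I -> groupalg K M) g :
  ga_mul (\sum_(i <- s) F i) g = \sum_(i <- s) ga_mul (F i) g.
Proof. exact: (big_morph (ga_mul^~ g) (fun _ _ => ga_mulDl _ _ _) (ga_mul0 g)). Qed.

Lemma ga_mul_sumr (I : Type) (s : seq I) (F : I -> groupalg K M) g :
  ga_mul g (\sum_(i <- s) F i) = \sum_(i <- s) ga_mul g (F i).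
Proof. by rewrite ga_mulC ga_mul_suml; apply: eq_bigr => i _; rewrite ga_mulC. Qed.

Lemma ga_mul1 : left_id ga_one ga_mul.
Proof.
move=> f; rewrite [RHS](monalgE f) {1}(monalgE f).
by rewrite ga_mul_sumr; apply: eq_bigr => a _; rewrite ga_mulUU mul1r add0r.
Qed.

Lemma ga_mulA : associative ga_mul.
Proof.
move=> f g h; rewrite (monalgE f) !(ga_mul_suml (msupp f)).
apply: eq_bigr => a _; rewrite (monalgE g) (ga_mul_suml (msupp g)).
rewrite !(ga_mul_sumr (msupp g)) (ga_mul_suml (msupp g)).
apply: eq_bigr => b _; rewrite (monalgE h) !(ga_mul_sumr (msupp h)).
by apply: eq_bigr => c _; rewrite !ga_mulUU mulrA addrA.
Qed.

Lemma ga_one_neq0 : ga_one != 0.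
Proof. by rewrite monalgU_eq0 oner_eq0. Qed.

HB.instance Definition _ := GRing.Zmodule_isComNzRing.Build (groupalg K M)
  ga_mulA ga_mulC ga_mul1 ga_mulDl ga_one_neq0.

End GroupAlgebra.

(* ---------------------------------------------------------------------- *)
(* Ideals and multiplicities.  Ideals need not be proper.                   *)

Section Ideals.
Variable A : comNzRingType.
Implicit Types I P Q : set A.

Definition is_ideal I :=
  [/\ I 0, (forall a b, I a -> I b -> I (a + b)) & forall a b, I b -> I (a * b)].

Definition ideal_gen (S : set A) : set A := smallest is_ideal S.

Definition is_prime_ideal P :=
  [/\ is_ideal P, ~ P 1 & forall a b, P (a * b) -> P a \/ P b].

Definition is_minimal_prime I P :=
  [/\ is_prime_ideal P, I `<=` P &
      forall Q, is_prime_ideal Q -> I `<=` Q -> Q `<=` P -> Q = P].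

(* Contraction along A -> A_P identifies the ideals of A_P, inclusions      *)
(* included, with the ideals Q of A such that s * a \in Q and s \notin P    *)
(* imply a \in Q.                                                           *)
Definition is_local_ideal P Q :=
  is_ideal Q /\ forall s a, ~ P s -> Q (s * a) -> Q a.

(* Strict chains N_0 < ... < N_k of A_P-submodules of (A / I)_P.            *)
Definition has_local_chain I P (k : nat) :=
  exists N : 'I_k.+1 -> set A,
    (forall i, is_local_ideal P (N i) /\ I `<=` N i) /\
    (forall i j : 'I_k.+1, (i < j)%N -> N i `<` N j).

Definition has_local_length I P (l : nat) :=
  has_local_chain I P l /\ forall k, has_local_chain I P k -> (k <= l)%N.

(* The sum, over the minimal primes P of I, of the length of (A / I)_P,     *)
(* is m.                                                                    *)
Definition has_multiplicity I (m : nat) :=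
  exists (k : nat) (P : 'I_k -> set A) (l : 'I_k -> nat),
    [/\ injective P,
        (forall Q, is_minimal_prime I Q <-> exists i, Q = P i),
        (forall i, has_local_length I (P i) (l i)) &
        m = (\sum_i l i)%N].

End Ideals.

(* ---------------------------------------------------------------------- *)
(* Tropicalization of the closed subscheme defined by an ideal I of K[M] in *)
(* the torus with character lattice M, for the trivial valuation on K and   *)
(* the min convention.  A point of the real cocharacter space enters        *)
(* through its pairing u : M -> R with the characters.                      *)

Section Tropicalization.
Variables (K : comNzRingType) (M : zmodType) (R : realType).

Definition init_form (u : M -> R) (f : groupalg K M) : groupalg K M :=
  \sum_(m <- msupp f | all (fun m' => u m <= u m') (msupp f)) << f@_m *g m >>.

Definition init_ideal (u : M -> R) (I : set (groupalg K M)) :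
    set (groupalg K M) :=
  ideal_gen (init_form u @` I).

Definition trop (N : Type) (pairing : N -> M -> R) (I : set (groupalg K M)) :
    set N :=
  [set p | init_ideal (pairing p) I <> [set: groupalg K M]].

End Tropicalization.

(* ---------------------------------------------------------------------- *)
(* Matroids on 'I_n, given by their sets of bases.                          *)

Section Matroids.
Variable n : nat.
Implicit Types (M : {set {set 'I_n}}) (S F : {set 'I_n}).

Definition dual_matroid M : {set {set 'I_n}} := [set ~: B | B in M]%SET.

Definition is_loop M (i : 'I_n) := forall B, B \in M -> i \notin B.

Definition is_coloop M (i : 'I_n) := is_loop (dual_matroid M) i.

Definition mrank M S : nat := (\max_(B in M) #|B :&: S|)%N.

Definition is_flat M F : bool :=
  [forall i, (i \notin F) ==> (mrank M F < mrank M (i |: F))%N].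

End Matroids.

(* Points of N_E = R^E / R e_E are given by their representatives in R^E:   *)
(* a subset of N_E (or of N_{E,E}) is described by its preimage in R^E (or  *)
(* in R^E * R^E).                                                           *)

Section Fans.
Variables (R : realType) (n : nat).

Definition evec (S : {set 'I_n}) : 'rV[R]_n := \row_i (i \in S)%:R.

Definition is_flag_of_flats (M : {set {set 'I_n}}) (s : seq {set 'I_n}) : bool :=
  sorted (fun F G : {set 'I_n} => F \proper G) s &&
  all (fun F => [&& is_flat M F, F != finset.set0 & F != [set: 'I_n]%SET]) s.

Definition flag_cone (s : seq {set 'I_n}) : set 'rV[R]_n :=
  [set x | exists (c : R) (a : {set 'I_n} -> R),
     (forall F, F \in s -> 0 <= a F) /\
     x = c *: evec [set: 'I_n]%SET + \sum_(F <- s) a F *: evec F].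

Definition bergman_fan (M : {set {set 'I_n}}) : set (set 'rV[R]_n) :=
  [set flag_cone s | s in [set s | is_flag_of_flats M s]].

Definition mu (p : 'rV[R]_n * 'rV[R]_n) : 'rV[R]_n * 'rV[R]_n :=
  (p.1, p.1 + p.2).

Definition opp_fan (S : set (set 'rV[R]_n)) : set (set 'rV[R]_n) :=
  [set -%R @` s | s in S].

Definition prod_fan (S T : set (set 'rV[R]_n)) :
    set (set ('rV[R]_n * 'rV[R]_n)) :=
  [set s `*` t | s in S & t in T].

Definition Delta_fan (M : {set {set 'I_n}}) : set (set ('rV[R]_n * 'rV[R]_n)) :=
  [set (fun p => - mu p) @` s |
     s in prod_fan (opp_fan (bergman_fan M)) (bergman_fan (dual_matroid M))].

Definition fan_support (T : Type) (S : set (set T)) : set T := \bigcup_(s in S) s.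

(* p lies on S, and near p the set S is a translate of a linear subspace.   *)
(* The weights of a tropical variety live at such points, among which are   *)
(* the relative interiors of the maximal cones of any fan structure.        *)
Definition is_regular_point (S : set ('rV[R]_n * 'rV[R]_n))
    (p : 'rV[R]_n * 'rV[R]_n) :=
  S p /\ exists L : {vspace 'rV[R]_n * 'rV[R]_n},
           \forall q \near p, S q <-> (q - p) \in L.

End Fans.

(* ---------------------------------------------------------------------- *)
(* The character lattice of the projectivized torus in P^(n-1): Laurent     *)
(* monomials of degree 0.                                                   *)

Section Characters.
Variable n : nat.

Definition degree0 : {pred 'rV[int]_n} := fun a => \sum_i a 0 i == 0.

Lemma degree0_zmod_closed : zmod_closed degree0.
Proof.
split; first by rewrite unfold_in big1 // => i _; rewrite mxE.
move=> a b; rewrite !unfold_in => /eqP a0 /eqP b0.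
under eq_bigr do rewrite !mxE.
by rewrite sumrB a0 b0 subrr.
Qed.

HB.instance Definition _ :=
  GRing.isZmodClosed.Build 'rV[int]_n degree0 degree0_zmod_closed.

Record charlat : predArgType := Charlat {
  char_val :> 'rV[int]_n;
  _ : char_val \in degree0 }.

HB.instance Definition _ := [isSub for char_val].
HB.instance Definition _ := [Choice of charlat by <:].
HB.instance Definition _ := [SubChoice_isSubZmodule of charlat by <:].

Lemma char_ratio_subproof (i j : 'I_n) :
  (delta_mx 0 i - delta_mx 0 j : 'rV[int]_n) \in degree0.
Proof.
have sum1 (k : 'I_n) : \sum_l ((l == k)%:R : int) = 1.
  by rewrite (bigD1 k) //= eqxx big1 ?addr0 // => l /negbTE ->.
rewrite unfold_in; under eq_bigr do rewrite !mxE /=.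
by rewrite sumrB !sum1 subrr.
Qed.

(* The quotient of the i-th by the j-th homogeneous coordinate.             *)
Definition char_ratio (i j : 'I_n) : charlat :=
  Charlat (char_ratio_subproof i j).

End Characters.

(* The character (a, b) stands for \prod_i w_i ^ a_i * \prod_i beta_i ^ b_i  *)
(* on T_E * T_{E*}.  The sign comes from e_i^* = - e_i: the element (x, y)  *)
(* of N_{E,E} is the cocharacter \sum_i x_i e_i of T_E together with        *)
(* \sum_i (- y_i) e_i^* of T_{E*}.                                          *)
Definition torus_pairing (R : realType) (n : nat) (p : 'rV[R]_n * 'rV[R]_n)
    (m : charlat n * charlat n) : R :=
  \sum_i p.1 0 i * (char_val m.1 0 i)%:~R +
  \sum_i (- p.2 0 i) * (char_val m.2 0 i)%:~R.

Section Configurations.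
Variables (F : fieldType) (n : nat).

Definition restr (B : {set 'I_n}) : 'Hom('rV[F]_n, 'rV[F]_#|B|) :=
  linfun (colsub (enum_val : 'I_#|B| -> 'I_n)).

Definition config_matroid (W : {vspace 'rV[F]_n}) : {set {set 'I_n}} :=
  [set B : {set 'I_n} |
     (lker (restr B) :&: W == 0)%VS && (restr B @: W == fullv)%VS]%SET.

(* Linear forms \sum_i a_i y_i vanishing on W, made of degree 0.            *)
Definition subspace_equations (W : {vspace 'rV[F]_n}) :
    set (groupalg F (charlat n * charlat n)%type) :=
  [set f | exists (a : 'rV[F]_n) (j : 'I_n),
     (forall w, w \in W -> \sum_i a 0 i * w 0 i = 0) /\
     f = \sum_i << a 0 i *g (char_ratio i j, 0) >>].

(* The values at v in W of the W^*-valued form \sum_i beta_i w_i l_i, made  *)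
(* of bidegree (0, 0).                                                      *)
Definition incidence_equations (W : {vspace 'rV[F]_n}) :
    set (groupalg F (charlat n * charlat n)%type) :=
  [set f | exists (v : 'rV[F]_n) (j k : 'I_n), v \in W /\
     f = \sum_i << v 0 i *g (char_ratio i j, char_ratio i k) >>].

(* The ideal of the closed subscheme Lambda_W^o of T_E * T_{E*}.            *)
Definition Lambda_ideal (W : {vspace 'rV[F]_n}) :
    set (groupalg F (charlat n * charlat n)%type) :=
  ideal_gen (subspace_equations W `|` incidence_equations W).

End Configurations.

(* Main.v *)
(** Write [p = (x, z)] and [gamma_i = beta_i w_i].  In the coordinates
    [(w, gamma)] the variety Lambda_W^o is the product of the linear spaces W and
    W^perp, cut out by the linear forms in W^perp and in W, and the point [p]
    becomes the weight [(x, x - z)].  A weight lies in the support of a Bergman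
    fan iff no linear form attains its minimal weight at a single coordinate,
    because its superlevel sets are then flats; when this fails, an initial form
    is a unit.  When it holds, expand the coordinates through a basis of maximal
    weight: the truncated expansions are initial forms, and every torus point of
    the linear space they define is the limit of a curve
    [w_i = \sum_b C_ib s_b z^(u_b)] in the original space, rescaled by
    [z^(u_i)], so the initial ideal vanishes there.  An ideal of Laurent
    polynomials squeezed in this way between linear equations and the vanishing
    ideal of their zero set is prime, hence proper and of multiplicity one. *)

Require Import Defs.
From HB Require Import structures.
From mathcomp Require Import all_boot all_order all_algebra.
From mathcomp Require Import finmap monalg complex.
From mathcomp Require Import boolp classical_sets functions reals.
From mathcomp Require Import topology normedtype sequences exp.
From mathcomp Require Import ring lra.

Set Implicit Arguments.
Unset Strict Implicit.
Unset Printing Implicit Defensive.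

Import Order.TTheory GRing.Theory Num.Theory.
Import numFieldNormedType.Exports.

Local Open Scope classical_set_scope.
Local Open Scope ring_scope.

(** * Ideals and initial forms in group algebras *)

Section IdealTheory.
Variable A : comNzRingType.
Implicit Types (S I P Q : set A).

Lemma ideal_gen_ideal S : is_ideal (ideal_gen S).
Proof.
split=> [J [[]]//|a b Ja Jb J JS|a b Jb J JS].
  by case: (JS) => -[_ JD _] _; apply: JD; [exact: Ja|exact: Jb].
by case: (JS) => -[_ _ JM] _; apply: JM; exact: Jb.
Qed.

Lemma sub_ideal_gen S : S `<=` ideal_gen S.
Proof. exact: sub_gen_smallest. Qed.

Lemma ideal_gen_min S I : is_ideal I -> S `<=` I -> ideal_gen S `<=` I.
Proof. exact: smallest_sub. Qed.

Lemma ideal_full I : is_ideal I -> I 1 -> I = [set: A].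
Proof.
move=> [_ _ IM] I1; apply/seteqP; split=> // a _.
by rewrite -[a]mulr1; apply: IM.
Qed.

(** The only minimal prime over [P] is [P] itself, and the localization of [A / P] there is a field,
    hence of length one. *)
Lemma prime_ideal_multiplicity P : is_prime_ideal P -> has_multiplicity P 1.
Proof.
move=> P_prime; have [P_ideal P1 PM] := P_prime; have [P0 _ _] := P_ideal.
exists 1%N, (fun=> P), (fun=> 1%N); split.
- by move=> i j _; rewrite !ord1.
- move=> Q; split=> [[[Q_ideal Q1 QM] PQ Qmin]|[_ ->]].
    by exists ord0; apply/esym; apply: Qmin.
  by split=> // Q' _ PQ QP; apply/seteqP.
- move=> _; split.
    exists (fun i : 'I_2 => if i == ord0 then P else [set: A]); split.
      move=> i; case: ifP => _; split=> //; split=> //.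
      by move=> s a Ps /PM[].
    move=> i j lt_ij; have -> : i = ord0.
      by apply/val_inj/eqP; have := ltn_ord j; rewrite /= -leqn0; case: j lt_ij => -[|[]].
    rewrite eqxx; case: eqP lt_ij => [->|_ _] //.
    by split=> // TP; apply: P1; apply: TP.
  move=> k [N [N_loc N_lt]]; rewrite leqNgt; apply/negP => k_gt1.
  have lt1 : (1 < k.+1)%N by rewrite (ltn_trans k_gt1).
  have lt2 : (2 < k.+1)%N by [].
  have [_ /nonsubset[a [N1a N0a]]] := N_lt ord0 (Ordinal lt1) isT.
  have [_ /nonsubset[b [_ N1b]]] := N_lt (Ordinal lt1) (Ordinal lt2) isT.
  have [[_ PN0] [[N1_ideal N1_loc] _]] := (N_loc ord0, N_loc (Ordinal lt1)).
  (* [a] lies outside [P], so it may be cancelled from [a * 1]; the middle term of the chain is then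
     the whole ring, and nothing lies strictly above it. *)
  have N11 : N (Ordinal lt1) 1 by apply: (N1_loc a) => [/PN0//|]; rewrite mulr1.
  by apply: N1b; rewrite (ideal_full N1_ideal N11).
- by rewrite big_ord_recl big_ord0.
Qed.

End IdealTheory.

Section Evaluation.
Variables (K : comNzRingType) (M : zmodType).
Implicit Types (f g : groupalg K M) (chi : M -> K).

Lemma ga_mulE f g : f * g = ga_mul f g. Proof. by []. Qed.

Lemma ga_mulU (c d : K) (a b : M) :
  (<< c *g a >> : groupalg K M) * << d *g b >> = << c * d *g a + b >>.
Proof. exact: ga_mulUU. Qed.

Lemma ga_mulU_sumr (I : Type) (s : seq I) (c : K) (a : M) (d : I -> K) (e : I -> M) :
  (<< c *g a >> : groupalg K M) * (\sum_(i <- s) << d i *g e i >>) =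
  \sum_(i <- s) << c * d i *g a + e i >>.
Proof. by rewrite ga_mulE ga_mul_sumr; apply: eq_bigr => i _; exact: ga_mulUU. Qed.

Lemma ga_oneE : 1 = << 1 *g 0 >> :> groupalg K M. Proof. by []. Qed.

Definition ga_eval chi f : K := \sum_(m <- msupp f) f@_m * chi m.

Lemma ga_evalw chi (d : {fset M}) f : (msupp f `<=` d)%fset ->
  ga_eval chi f = \sum_(m <- d) f@_m * chi m.
Proof.
move=> le_d; apply: big_fset_incl => // m _ /mcoeff_outdom ->.
by rewrite mul0r.
Qed.

Lemma ga_eval0 chi : ga_eval chi 0 = 0.
Proof. by rewrite /ga_eval msupp0 big_seq_fset0. Qed.

Lemma ga_evalD chi f g : ga_eval chi (f + g) = ga_eval chi f + ga_eval chi g.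
Proof.
rewrite (ga_evalw _ (msuppD_le f g)) (ga_evalw _ (fsubsetUl (msupp f) (msupp g))).
rewrite (ga_evalw _ (fsubsetUr (msupp f) (msupp g))) -big_split /=.
by apply: eq_bigr => m _; rewrite mcoeffD mulrDl.
Qed.

Lemma ga_evalU chi c m : ga_eval chi << c *g m >> = c * chi m.
Proof. by rewrite (ga_evalw _ msuppU_le) big_seq_fset1 mcoeffUU. Qed.

Lemma ga_eval_sum chi (I : Type) (s : seq I) (P : pred I) (F : I -> groupalg K M) :
  ga_eval chi (\sum_(i <- s | P i) F i) = \sum_(i <- s | P i) ga_eval chi (F i).
Proof. exact: (big_morph _ (ga_evalD chi) (ga_eval0 chi)). Qed.

Lemma ga_evalM chi f g : (forall a b, chi (a + b) = chi a * chi b) ->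
  ga_eval chi (f * g) = ga_eval chi f * ga_eval chi g.
Proof.
move=> chiD; rewrite ga_mulE /ga_mul (ga_eval_sum chi (msupp f)) [X in X * _]/ga_eval mulr_suml.
apply: eq_bigr => a _; rewrite (ga_eval_sum chi (msupp g)) [X in _ * X]/ga_eval mulr_sumr.
by apply: eq_bigr => b _; rewrite ga_evalU chiD mulrACA.
Qed.

Lemma ga_eval_kernel_ideal chi : (forall a b, chi (a + b) = chi a * chi b) ->
  is_ideal [set f | ga_eval chi f = 0].
Proof.
move=> chiD; split=> /= [|f g f0 g0|f g g0]; first exact: ga_eval0.
  by rewrite ga_evalD f0 g0 addr0.
by rewrite ga_evalM// g0 mulr0.
Qed.

End Evaluation.

Section InitialForms.
Variables (K : comNzRingType) (M : zmodType) (R : realType).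
Implicit Types (f : groupalg K M) (u : M -> R).

Lemma mcoeff_init_form u f m :
  (init_form u f)@_m =
  if all (fun m' => u m <= u m') (msupp f) then f@_m else 0.
Proof.
rewrite /init_form (raddf_sum (mcoeff m)) /=.
under eq_bigr do rewrite mcoeffU.
case: ifP => [um|um].
  have [mf|mf] := boolP (m \in msupp f); last first.
    rewrite mcoeff_outdom// big_seq_cond big1// => i /andP[fi _].
    by case: eqP => // ei; rewrite ei (negbTE mf) in fi.
  rewrite big_mkcond (big_fsetD1 m)//= um eqxx big1_fset ?addr0// => i.
  by rewrite !inE => /andP[/negbTE -> _] _; case: ifP.
apply: big1_seq => i /andP[ui _]; case: eqP => // ei.
by rewrite ei um in ui.
Qed.

Lemma mcoeff_init_form_min u f m0 m : m0 \in msupp f ->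
  (forall m', m' \in msupp f -> u m0 <= u m') ->
  (init_form u f)@_m = if u m == u m0 then f@_m else 0.
Proof.
move=> fm0 m0min; rewrite mcoeff_init_form.
have [fm|/mcoeff_outdom ->] := boolP (m \in msupp f); last by rewrite !if_same.
congr (if _ then _ else _); apply/allP/eqP => [um|-> //].
by apply/le_anti; rewrite um// m0min.
Qed.

(** Injectivity of [g] keeps the terms from merging, so the support is exactly the set of [g i] with
    [a i != 0]. *)
Lemma init_form_linear n u (g : 'I_n -> M) (a : 'I_n -> K) i0 : injective g ->
  a i0 != 0 -> (forall i, a i != 0 -> u (g i0) <= u (g i)) ->
  init_form u (\sum_i << a i *g g i >>) =
  \sum_i << (if u (g i) == u (g i0) then a i else 0) *g g i >>.
Proof.
move=> g_inj ai0 i0min.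
have coefE (b : 'I_n -> K) m :
    (\sum_i << b i *g g i >> : {malg K[M]})@_m = \sum_(i | g i == m) b i.
  by rewrite (raddf_sum (mcoeff m)) [RHS]big_mkcond; apply: eq_bigr => i _;
     rewrite /= mcoeffU; case: eqP.
have coefEg (b : 'I_n -> K) i :
    (\sum_i << b i *g g i >> : {malg K[M]})@_(g i) = b i.
  by rewrite coefE (big_pred1 i)// => j; rewrite /= (inj_eq g_inj).
have supp m : m \in msupp (\sum_i << a i *g g i >> : {malg K[M]}) ->
    exists2 i, m = g i & a i != 0.
  rewrite -mcoeff_neq0 coefE => nz.
  have [i /eqP im|no] := pickP (fun i => g i == m); last by rewrite big_pred0 ?eqxx in nz.
  exists i => //; move: nz; rewrite -im; apply: contra_neq => ai.
  by rewrite (big_pred1 i)// => j; rewrite /= (inj_eq g_inj).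
apply/malgP => m; rewrite (@mcoeff_init_form_min _ _ (g i0)).
- rewrite !coefE; case: ifP => um.
    by apply: eq_bigr => i /eqP ->; rewrite um.
  by rewrite big1// => i /eqP ->; rewrite um.
- by rewrite -mcoeff_neq0 coefEg.
- by move=> m' /supp[i -> ai]; apply: i0min.
Qed.

End InitialForms.

(** * Primality of linear ideals *)

Lemma poly_nat_nonroot (R : numDomainType) (p : {poly R}) (N0 : nat) :
  p != 0 -> exists2 N : nat, (N0 <= N)%N & p.[N%:R] != 0.
Proof.
move=> p0; pose rs := [seq (i%:R : R) | i <- iota N0 (size p)].
have [rs_root|/allPn[x /mapP[N]]] := boolP (all (root p) rs).
  have rs_uniq : uniq rs.
    by rewrite map_inj_uniq ?iota_uniq// => i j /eqP; rewrite eqr_nat => /eqP.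
  by have := max_poly_roots p0 rs_root rs_uniq; rewrite size_map size_iota ltnn.
by rewrite mem_iota => /andP[N0N _] -> pN; exists N.
Qed.

Lemma poly_sum_monomials_neq0 (R : nzRingType) (I : eqType) (s : seq I)
    (c : I -> R) (k : I -> nat) (i : I) :
  uniq s -> {in s &, injective k} -> i \in s -> c i != 0 ->
  \sum_(j <- s) c j *: 'X^(k j) != 0.
Proof.
move=> s_uniq k_inj si ci; apply/eqP => /(congr1 (fun p : {poly R} => p`_(k i))).
rewrite coef0 coef_sum (bigD1_seq i)//= coefZ coefXn eqxx mulr1 big_seq_cond big1 ?addr0.
  by apply/eqP.
move=> j /andP[sj ji]; rewrite coefZ coefXn; case: eqP => [/k_inj e|]; last by rewrite mulr0.
by rewrite e// eqxx in ji.
Qed.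

(* An ideal [Q] of Laurent polynomials containing the linear relations       *)
(* [x_t = \sum_b C t b * x_b] and vanishing at the torus points of the linear *)
(* space they define is prime: modulo [Q] and units, every element involves  *)
(* only the coordinates in [B], and a nonzero such element is nonzero at a   *)
(* point [x_b = z ^ (N ^ b)] of that space.                                  *)
Section LinearIdeals.
Variables (K : numFieldType) (T : finType) (M : zmodType).
Variables (ex : M -> T -> int) (B : {set T}) (C : T -> T -> K) (el : T -> T -> M).
Variable Q : set (groupalg K M).

Local Notation mono c m := (<< c *g m >> : groupalg _ _).

Hypothesis exD : forall a b t, ex (a + b) t = ex a t + ex b t.
Hypothesis ex_inj : forall a, (forall t, ex a t = 0) -> a = 0.
Hypothesis C_supp : forall t b, C t b != 0 -> b \in B.
Hypothesis C_delta : forall b b', b \in B -> C b b' = (b == b')%:R.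
Hypothesis C_row : forall t, exists b, C t b != 0.
Hypothesis ex_el : forall t b, C t b != 0 ->
  forall s, ex (el b t) s = (s == b)%:R - (s == t)%:R.
Hypothesis Q_ideal : is_ideal Q.
Hypothesis Q_lin : forall t, t \notin B -> Q (1 - \sum_b mono (C t b) (el b t)).

Definition torus_char (w : T -> K) (m : M) : K := \prod_t w t ^ ex m t.

Definition linpt (s : T -> K) (t : T) : K := \sum_b C t b * s b.

Hypothesis Q_vanish : forall s, (forall t, linpt s t != 0) ->
  forall f, Q f -> ga_eval (torus_char (linpt s)) f = 0.

Let ex0 t : ex 0 t = 0.
Proof. by apply: (addrI (ex 0 t)); rewrite -exD !addr0. Qed.

Let exN a t : ex (- a) t = - ex a t.
Proof. by apply: (addrI (ex a t)); rewrite -exD !addrN ex0. Qed.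

Let ex_sum (I : Type) (r : seq I) (P : pred I) (F : I -> M) t :
  ex (\sum_(i <- r | P i) F i) t = \sum_(i <- r | P i) ex (F i) t.
Proof. exact: (big_morph (ex^~ t) (fun a b => exD a b t) (ex0 t)). Qed.

Let exMn a k t : ex (a *+ k) t = ex a t *+ k.
Proof. by elim: k => [|k IH]; rewrite ?mulr0n ?mulrS ?exD ?IH. Qed.

Lemma torus_charD w : (forall t, w t != 0) ->
  forall a b, torus_char w (a + b) = torus_char w a * torus_char w b.
Proof.
move=> w0 a b; rewrite /torus_char -big_split /=.
by apply: eq_bigr => t _; rewrite exD expfzDr.
Qed.

Let onB (h : groupalg K M) := forall m t, h@_m != 0 -> t \notin B -> ex m t = 0.

Let S (f : groupalg K M) := exists2 h, onB h & Q (f - h).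

Let onBD f g : onB f -> onB g -> onB (f + g).
Proof.
move=> fB gB m t; rewrite mcoeffD => fg tB.
have [f0|f0] := eqVneq (f@_m) 0; last exact: fB f0 tB.
by apply: gB tB; move: fg; rewrite f0 add0r.
Qed.

Let SD f g : S f -> S g -> S (f + g).
Proof.
move=> [hf hfB Qf] [hg hgB Qg]; exists (hf + hg); first exact: onBD.
by rewrite opprD addrACA; have [_ QD _] := Q_ideal; apply: QD.
Qed.

Let onB0 : onB 0.
Proof. by move=> m t; rewrite mcoeff0 eqxx. Qed.

Let S0 : S 0.
Proof. by exists 0; [exact: onB0|rewrite subr0; have [] := Q_ideal]. Qed.

Let SZ c f : S f -> S (mono c 0 * f).
Proof.
move=> [h hB Qh]; exists (mono c 0 * h); last first.
  by rewrite -mulrBr; have [_ _ QM] := Q_ideal; apply: QM.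
move=> m t; rewrite (monalgE h) mulr_sumr => cm tB.
have [hm|hm] := eqVneq (h@_m) 0; last exact: hB hm tB.
move: cm; rewrite (raddf_sum (mcoeff m)) big1_seq ?eqxx// => i /andP[_ hi].
rewrite ga_mulU /= mcoeffU add0r; case: eqP => // im.
by move: hi; rewrite -mcoeff_neq0 im hm eqxx.
Qed.

Let S_sum (I : Type) (r : seq I) (F : I -> groupalg K M) :
  (forall i, S (F i)) -> S (\sum_(i <- r) F i).
Proof. by move=> SF; elim/big_ind: _ => [||i _]; [exact: S0|exact: SD|]. Qed.

Let S_Q f g : S g -> Q (f - g) -> S f.
Proof.
move=> [h hB Qh] Qfg; exists h => //.
by have [_ QD _] := Q_ideal; rewrite -(subrKA g); apply: QD.
Qed.

(** Induction on the total degree outside [B]: multiplying the relation for [t] by the monomial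
    trades one factor [x_t] for coordinates in [B] and leaves the other exponents outside [B] alone.
    Exponents only go down, hence the sign condition. *)
Let S_mono k : forall m, (forall t, t \notin B -> 0 <= ex m t) ->
  (\sum_(t | t \notin B) `|ex m t| <= k)%N -> S (mono 1 m).
Proof.
elim: k => [|k IH] m m_ge0 mk.
  exists (mono 1 m); last by rewrite subrr; have [] := Q_ideal.
  move=> m' t; rewrite mcoeffU; case: (m =P m') => [<- _ tB|_]; last by rewrite eqxx.
  move: mk; rewrite leqn0 sum_nat_eq0 => /forallP/(_ t).
  by rewrite tB absz_eq0 => /eqP.
have [/existsP[t /andP[tB mt]]|m0] := boolP [exists t, (t \notin B) && (0 < ex m t)]; last first.
  apply: IH => //; rewrite big1// => t tB.
  apply/eqP; rewrite absz_eq0 eq_le m_ge0// andbT leNgt.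
  by apply: contra m0 => mt; apply/existsP; exists t; rewrite tB.
apply: (@S_Q _ (\sum_b mono (C t b) 0 * mono 1 (m + el b t))).
  apply: S_sum => b; have [->|Cb] := eqVneq (C t b) 0.
    by rewrite monalgU0 mul0r; exact: S0.
  apply: SZ; apply: IH => [s sB|]; first (rewrite exD ex_el//).
    have /negbTE-> : s != b by apply: contraNneq sB => ->; exact: C_supp Cb.
    rewrite sub0r subr_ge0; have [->|_] := eqVneq s t; last exact: m_ge0.
    by rewrite -gtz0_ge1.
  rewrite -ltnS (leq_trans _ mk)//.
  rewrite (bigD1 t)//= [leqRHS](bigD1 t)//= -addSn leq_add//.
    rewrite exD ex_el// eqxx; have /negbTE-> : t != b.
      by apply: contraNneq tB => ->; exact: C_supp Cb.
    by case: (ex m t) mt => // -[|j] // _; rewrite sub0r intS addrAC subrr add0r.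
  apply: leq_sum => s /andP[sB st]; rewrite exD ex_el// (negbTE st) subr0.
  have /negbTE-> : s != b by apply: contraNneq sB => ->; exact: C_supp Cb.
  by rewrite addr0.
have [_ _ QM] := Q_ideal; have := QM (mono 1 m) _ (Q_lin tB).
rewrite mulrBr mulr1 mulr_sumr; congr (Q (_ - _)); apply: eq_bigr => b _.
by rewrite !ga_mulU mulr1 mul1r add0r.
Qed.

(** A unit monomial clears all negative exponents outside [B], after which every term can be
    reduced. *)
Let S_shift f : exists d, S (mono 1 d * f).
Proof.
pose N := (\sum_(m <- msupp f) \sum_t `|ex m t|)%N.
pose b t := xchoose (C_row t).
have Cb t : C t (b t) != 0 by exact: (xchooseP (C_row t)).
(* Each summand is the [N]-th power of [x_t / x_b] with [b] in [B]: the exponent at [t] is raised by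
   [N] and the compensation falls inside [B]. *)
pose d := \sum_(t | t \notin B) (- el (b t) t) *+ N.
have exd t : t \notin B -> ex d t = N%:Z.
  move=> tB; rewrite ex_sum (bigD1 t)//= big1 => [|s /andP[sB st]].
    rewrite addr0 exMn exN ex_el// eqxx; have /negbTE-> : t != b t.
      by apply: contraNneq tB => ->; exact: C_supp (Cb t).
    by rewrite sub0r opprK -natz.
  rewrite exMn exN ex_el//; have /negbTE-> : t != b s.
    by apply: contraNneq tB => ->; exact: C_supp (Cb s).
  by rewrite eq_sym (negbTE st) subrr oppr0 mul0rn.
exists d; rewrite (monalgE f) mulr_sumr big_seq.
elim/big_ind: _ => [||m fm]; [exact: S0|exact: SD|].
rewrite ga_mulU mul1r.
have -> : mono (f@_m) (d + m) = mono (f@_m) 0 * mono 1 (d + m).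
  by rewrite ga_mulU mulr1 add0r.
apply: SZ; apply: (@S_mono (\sum_(t | t \notin B) `|ex (d + m) t|)%N _ _ (leqnn _)) => t tB.
rewrite exD exd// addrC -lerBlDr sub0r.
have : (`|ex m t| <= N)%N.
  rewrite /N (big_fsetD1 m)//= (leq_trans _ (leq_addr _ _))//.
  by rewrite (bigD1 t)//= leq_addr.
by rewrite -lez_nat abszE => /lerNnormlW.
Qed.

(** Kronecker substitution: a nonzero exponent vector is the coefficient vector of a nonzero
    polynomial in [N], and the product of finitely many of these has a natural number as
    non-root. *)
Let kronecker (D : seq M) : 0 \notin D ->
  exists2 N : nat, (1 < N)%N &
    forall m, m \in D -> \sum_t (N ^ enum_rank t)%N%:Z * ex m t != 0.
Proof.
move=> D0; pose p (m : M) : {poly int} := \sum_t ex m t *: 'X^(enum_rank t).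
have p0 : \prod_(m <- D) p m != 0.
  rewrite prodf_seq_neq0; apply/allP => m Dm /=.
  have [/existsP[t mt]|] := boolP [exists t, ex m t != 0].
    apply: (@poly_sum_monomials_neq0 _ _ _ _ _ t) => //.
    - exact: index_enum_uniq.
    - by move=> i j _ _ /val_inj/enum_rank_inj.
  rewrite negb_exists => /forallP m0; suff m_eq0 : m = 0 by rewrite -m_eq0 Dm in D0.
  by apply: ex_inj => t; apply/eqP/negPn; exact: m0.
have [N N2 pN] := poly_nat_nonroot 2 p0; exists N => // m Dm.
move: pN; rewrite horner_prod prodf_seq_neq0 => /allP/(_ m Dm)/=.
apply: contra_neq; rewrite /p horner_sum => m0.
by rewrite -[RHS]m0; apply: eq_bigr => t _; rewrite hornerZ hornerXn -natrX natz mulrC.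
Qed.

(** Along the curve [x_b = z ^ k b] distinct monomials of [h1], and of [h2], become distinct powers
    of [z]. All the quantities concerned are then nonzero polynomials in [z] up to a power of [z],
    so one value of [z] serves them all. *)
Let generic_point (h1 h2 : groupalg K M) : onB h1 -> onB h2 -> h1 != 0 -> h2 != 0 ->
  exists s, [/\ forall t, linpt s t != 0,
    ga_eval (torus_char (linpt s)) h1 != 0 &
    ga_eval (torus_char (linpt s)) h2 != 0].
Proof.
move=> h1B h2B h10 h20.
(* A weight that is nonzero on these differences is injective on the support. *)
pose diffs (h : groupalg K M) :=
  [seq d <- [seq x - y | x <- msupp h, y <- msupp h] | d != 0].
have D0 : 0 \notin diffs h1 ++ diffs h2 by rewrite mem_cat !mem_filter eqxx.
have [N N2 Nk] := kronecker D0.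
pose k (t : T) := (N ^ enum_rank t)%N; pose e (m : M) := \sum_t (k t)%:Z * ex m t.
have k_inj : injective k.
  by move=> t t' /(expnI N2)/val_inj/enum_rank_inj.
have eB a b : e (a - b) = e a - e b.
  by rewrite -sumrB; apply: eq_bigr => t _; rewrite exD exN mulrBr.
have e_inj h : {subset diffs h <= diffs h1 ++ diffs h2} -> {in msupp h &, injective e}.
  move=> hD x y hx hy exy; apply/eqP; rewrite -subr_eq0; apply/negPn/negP => xy.
  have /hD/Nk : x - y \in diffs h.
    by rewrite mem_filter xy; apply/allpairsP; exists (x, y).
  by rewrite -/(e (x - y)) eB exy subrr eqxx.
pose P t := \sum_b C t b *: 'X^(k b).
have P0 t : P t != 0.
  have [b Cb] := C_row t.
  apply: (@poly_sum_monomials_neq0 _ _ _ _ _ b) => //.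
  - exact: index_enum_uniq.
  - by move=> i j _ _ /k_inj.
(* This shift makes all exponents of [z] nonnegative, so that [H h] below is a genuine
   polynomial. *)
pose E (h : groupalg K M) := (\sum_(m <- msupp h) `|e m|)%N.
have E_ge h m : m \in msupp h -> 0 <= e m + (E h)%:Z.
  move=> hm; rewrite -lerBlDr sub0r.
  have : (`|e m| <= E h)%N by rewrite /E (big_fsetD1 m)//= leq_addr.
  by rewrite -lez_nat abszE => /lerNnormlW.
pose H (h : groupalg K M) := \sum_(m <- msupp h) h@_m *: 'X^(`|e m + (E h)%:Z|).
have H0 h : h != 0 -> {in msupp h &, injective e} -> H h != 0.
  move=> h0 ei; have /fset0Pn[m hm] : msupp (h : {malg K[M]}) != fset0.
    by apply: contra_neq h0 => h0; rewrite (monalgE h) h0 big_seq_fset0.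
  apply: (@poly_sum_monomials_neq0 _ _ _ _ _ m) => //; last by rewrite mcoeff_neq0.
  move=> x y hx hy /(congr1 Posz); rewrite !gez0_abs ?E_ge// => /addIr.
  exact: ei.
have PH : (\prod_t P t) * H h1 * H h2 != 0.
  rewrite !mulf_neq0//; [by apply/prodf_neq0| |].
    by apply/H0/e_inj => // x xD; rewrite mem_cat xD.
  by apply/H0/e_inj => // x xD; rewrite mem_cat xD orbT.
(* The lower bound 1 makes [z] invertible. *)
have [n n1] := poly_nat_nonroot 1 PH.
rewrite !hornerM horner_prod !mulf_eq0 !negb_or => /andP[/andP[Pn H1n] H2n].
pose z : K := n%:R; have z0 : z != 0 by rewrite pnatr_eq0 -lt0n.
pose s b := z ^+ k b; exists s.
have ptE t : linpt s t = (P t).[z].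
  by rewrite horner_sum; apply: eq_bigr => b _; rewrite hornerZ hornerXn.
have ptB b : b \in B -> linpt s b = z ^+ k b.
  move=> bB; rewrite /linpt (bigD1 b)//= C_delta// eqxx mul1r big1 ?addr0// => b' b'b.
  by rewrite C_delta// eq_sym (negbTE b'b) mul0r.
have charE h m : onB h -> m \in msupp h -> torus_char (linpt s) m = z ^ e m.
  move=> hB hm; rewrite /torus_char /e.
  rewrite (big_morph (fun j => z ^ j) (fun a b => expfzDr a b z0) (expr0z z)).
  apply: eq_bigr => t _; have [tB|tB] := boolP (t \in B).
    by rewrite ptB// -exprz_exp.
  by rewrite (hB m) ?mcoeff_neq0// mulr0 !expr0z.
have evalE h : onB h -> (H h).[z] != 0 -> ga_eval (torus_char (linpt s)) h != 0.
  move=> hB; apply: contra_neq => h0.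
  suff -> : (H h).[z] = z ^ (E h)%:Z * ga_eval (torus_char (linpt s)) h by rewrite h0 mulr0.
  rewrite /H horner_sum /ga_eval mulr_sumr big_seq [RHS]big_seq.
  apply: eq_bigr => m hm; rewrite hornerZ hornerXn mulrCA; congr (_ * _).
  by rewrite (charE h)// -expfzDr// addrC -[LHS]/(z ^ _%:Z) gez0_abs// addrC E_ge.
split; [|exact: evalE|exact: evalE].
by move=> t; rewrite ptE; move/prodf_neq0: Pn; apply.
Qed.

Lemma linear_ideal_prime : is_prime_ideal Q.
Proof.
have [_ _ QM] := Q_ideal; split=> //.
  move=> Q1; have oneB : onB 1.
    by move=> m t; rewrite ga_oneE mcoeffU; case: (0 =P m) => [<- _ _|_]; rewrite ?ex0 ?eqxx.
  have [s [s0 + _]] := generic_point oneB oneB (oner_neq0 _) (oner_neq0 _).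
  by rewrite Q_vanish ?eqxx.
(* If both reduced elements are nonzero, they are nonzero at a common point where [Q] vanishes, yet
   the product of their values there is a multiple of the value of [f * g]. *)
move=> f g Qfg; have [d1 [h1 h1B Q1]] := S_shift f; have [d2 [h2 h2B Q2]] := S_shift g.
have unshift d a : Q (mono 1 d * a) -> Q a.
  by move=> /(QM (mono 1 (- d))); rewrite mulrA ga_mulU mulr1 addNr -ga_oneE mul1r.
have [h10|h10] := eqVneq h1 0; first by left; apply: (unshift d1); rewrite -[X in Q X]subr0 -h10.
have [h20|h20] := eqVneq h2 0; first by right; apply: (unshift d2); rewrite -[X in Q X]subr0 -h20.
have [s [s0 h1s h2s]] := generic_point h1B h2B h10 h20.
have evB a b : Q (a - b) -> ga_eval (torus_char (linpt s)) a = ga_eval (torus_char (linpt s)) b.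
  by move=> Qab; rewrite -[a](subrK b) ga_evalD Q_vanish ?add0r.
have chD := torus_charD s0.
have := mulf_neq0 h1s h2s; rewrite -(evB _ _ Q1) -(evB _ _ Q2) !ga_evalM// mulrACA.
by rewrite -(ga_evalM f)// (Q_vanish s0 Qfg) mulr0 eqxx.
Qed.

End LinearIdeals.

(** * Initial degenerations as limits of curves *)

Lemma cvgn_bigop (K : numFieldType) (op : K -> K -> K) (x0 : K) :
  (forall (x y : nat -> K) (a b : K), x @ \oo --> a -> y @ \oo --> b ->
    op (x k) (y k) @[k --> \oo] --> op a b) ->
  forall (I : Type) (r : seq I) (x : I -> nat -> K) (a : I -> K),
  (forall i, x i @ \oo --> a i) ->
  \big[op/x0]_(i <- r) x i k @[k --> \oo] --> \big[op/x0]_(i <- r) a i.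
Proof.
move=> cvg_op I r x a xa; elim: r => [|i r IH].
  by rewrite big_nil; under eq_cvg do rewrite big_nil; exact: cvg_cst.
by rewrite big_cons; under eq_cvg do rewrite big_cons; exact: cvg_op.
Qed.

Lemma cvgn_sum (K : numFieldType) (I : Type) (r : seq I) (x : I -> nat -> K) (a : I -> K) :
  (forall i, x i @ \oo --> a i) ->
  \sum_(i <- r) x i k @[k --> \oo] --> \sum_(i <- r) a i.
Proof. by apply: cvgn_bigop => *; exact: cvgD. Qed.

Lemma cvgn_prod (K : numFieldType) (I : Type) (r : seq I) (x : I -> nat -> K) (a : I -> K) :
  (forall i, x i @ \oo --> a i) ->
  \prod_(i <- r) x i k @[k --> \oo] --> \prod_(i <- r) a i.
Proof. by apply: cvgn_bigop => *; exact: cvgM. Qed.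

Lemma cvgn_exprz (K : numFieldType) (x : nat -> K) (a : K) (j : int) : a != 0 ->
  x @ \oo --> a -> x k ^ j @[k --> \oo] --> a ^ j.
Proof.
move=> a0 xa; have xX i : x k ^+ i @[k --> \oo] --> a ^+ i.
  elim: i => [|i IH]; first by rewrite expr0; under eq_cvg do rewrite expr0; exact: cvg_cst.
  by rewrite exprS; under eq_cvg do rewrite exprS; exact: cvgM.
case: j => i; first exact: xX.
rewrite NegzE -exprnN; under eq_cvg do rewrite -exprnN.
by apply: cvgV => //; rewrite expf_neq0.
Qed.

Section InitialDegeneration.
Variables (K : numFieldType) (R : realType) (T : finType) (M : zmodType).
Variables (ex : M -> T -> int) (C : T -> T -> K) (U : T -> R) (u : M -> R).
Hypothesis exD : forall a b t, ex (a + b) t = ex a t + ex b t.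
Hypothesis C_le : forall t b, C t b != 0 -> U t <= U b.
Hypothesis u_ex : forall m, u m = \sum_t U t * (ex m t)%:~R.

(* [pexp k c] stands for [z_k ^ c], where [z_k] tends to [0+]. *)
Variable pexp : nat -> R -> K.
Hypothesis pexpD : forall k a b, pexp k (a + b) = pexp k a * pexp k b.
Hypothesis pexp_neq0 : forall k a, pexp k a != 0.
Hypothesis pexp_small : forall c e, 0 < c -> 0 < e ->
  exists N, forall k, (N <= k)%N -> `|pexp k c| < e.

(** Under [C_le], this is the limit of the matrix with entries [C t b * pexp k (U b - U t)]. *)
Definition init_mx (t b : T) : K := if U t == U b then C t b else 0.

Let pexp_lim c : 0 < c -> pexp k c @[k --> \oo] --> 0.
Proof.
move=> c0; apply/cvgrPdist_lt => e /(pexp_small c0)[N small].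
by exists N => // k /small; rewrite sub0r normrN.
Qed.

Let pexp0 k : pexp k 0 = 1.
Proof. by apply: (mulfI (pexp_neq0 k 0)); rewrite -pexpD addr0 mulr1. Qed.

Let pexpN k a : pexp k (- a) = (pexp k a)^-1.
Proof. by apply: (mulfI (pexp_neq0 k a)); rewrite -pexpD subrr pexp0 mulfV. Qed.

Let pexp_sum k (I : Type) (r : seq I) (F : I -> R) :
  pexp k (\sum_(i <- r) F i) = \prod_(i <- r) pexp k (F i).
Proof. exact: (big_morph _ (pexpD k) (pexp0 k)). Qed.

Let pexpz k a (j : int) : pexp k (a * j%:~R) = pexp k a ^ j.
Proof.
have pexpn i : pexp k (a * i%:R) = pexp k a ^+ i.
  by elim: i => [|i IH]; rewrite ?mulr0 ?pexp0// -nat1r mulrDr mulr1 pexpD IH exprS.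
case: j => i; first exact: pexpn.
by rewrite NegzE mulrNz mulrN pexpN pexpn exprnN.
Qed.

(** [f] vanishes at the points with parameters [s b * pexp k (U b)]. Divide coordinate [t] by
    [pexp k (U t)] and the value of [f] by its power of lowest weight; the limits are the point
    [linpt init_mx s] and the value of the initial form there. *)
Lemma init_form_eval_eq0 (I : set (groupalg K M)) :
  (forall w, (forall t, w t != 0) -> (exists s, w = linpt C s) ->
     forall f, I f -> ga_eval (torus_char ex w) f = 0) ->
  forall s, (forall t, linpt init_mx s t != 0) ->
  forall f, I f -> ga_eval (torus_char ex (linpt init_mx s)) (init_form u f) = 0.
Proof.
move=> I_vanish s s0 f If.
have [f0|/fset0Pn[m0' fm0']] := eqVneq (msupp (f : {malg K[M]})) fset0.
  suff -> : init_form u f = 0 by rewrite ga_eval0.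
  by apply/malgP => m; rewrite mcoeff_init_form mcoeff0 mcoeff_outdom ?f0 ?if_same// inE.
have [m0 fm0 m0min] : exists2 m0, m0 \in msupp f & forall m, m \in msupp f -> u m0 <= u m.
  pose i0 := [` fm0']%fset.
  case: (arg_minP (fun i : msupp f => u (val i)) (isT : xpredT i0)) => i _ imin.
  by exists (val i) => [|m fm]; [exact: valP|exact: (imin [` fm]%fset)].
pose w k t := linpt C (fun b => s b * pexp k (U b)) t.
pose phi k t := \sum_b C t b * s b * pexp k (U b - U t).
have wE k t : w k t = pexp k (U t) * phi k t.
  rewrite /w /linpt /phi mulr_sumr; apply: eq_bigr => b _.
  by rewrite [RHS]mulrCA -pexpD subrKC mulrA.
have phi_lim t : phi k t @[k --> \oo] --> linpt init_mx s t.
  apply: cvgn_sum => b; rewrite /init_mx; case: eqP => [->|/eqP Utb].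
    under eq_cvg do rewrite subrr pexp0 mulr1.
    exact: cvg_cst.
  have [Ctb|Ctb] := eqVneq (C t b) 0.
    under eq_cvg do rewrite Ctb !mul0r.
    by rewrite mul0r; exact: cvg_cst.
  rewrite mul0r -[X in _ --> X](mulr0 (C t b * s b)).
  by apply: cvgMl_tmp; apply: pexp_lim; rewrite subr_gt0 lt_neqAle Utb C_le.
(* [I] is known to vanish at torus points only; the curve is eventually in the torus because its
   rescaled limit is. *)
have phi_neq0 : \forall k \near \oo, forall t, phi k t != 0.
  apply: filter_forall => t.
  have := phi_lim t; move/cvgrPdist_lt/(_ `|linpt init_mx s t|).
  rewrite normr_gt0 => /(_ (s0 t)); apply: filterS => k.
  by apply: contraTneq => ->; rewrite subr0 ltxx.
have charE k m : torus_char ex (w k) m = pexp k (u m) * torus_char ex (phi k) m.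
  rewrite /torus_char u_ex pexp_sum -big_split /=; apply: eq_bigr => t _.
  by rewrite wE expfzMl pexpz.
(* The value of [f] at [w k] divided by [pexp k (u m0)]: terms of minimal weight converge to those
   of the initial form, the others tend to zero. *)
pose F k := \sum_(m <- msupp f) f@_m * (pexp k (u m - u m0) * torus_char ex (phi k) m).
have F_lim : F k @[k --> \oo] --> ga_eval (torus_char ex (linpt init_mx s)) (init_form u f).
  have sub : (msupp (init_form u f) `<=` msupp f)%fset.
    apply/fsubsetP => m; rewrite -!mcoeff_neq0 mcoeff_init_form.
    by case: ifP => // _; rewrite eqxx.
  rewrite (ga_evalw _ sub).
  have char_lim m : torus_char ex (phi k) m @[k --> \oo] --> torus_char ex (linpt init_mx s) m.
    by apply: cvgn_prod => t; exact: cvgn_exprz.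
  apply: cvgn_sum => m; rewrite (mcoeff_init_form_min _ fm0 m0min).
  have [um|um] := eqVneq (u m) (u m0).
    under eq_cvg do rewrite um subrr pexp0 mul1r.
    by apply: cvgMl_tmp.
  have [fm|/mcoeff_outdom fm] := boolP (m \in msupp f); last first.
    under eq_cvg do rewrite fm mul0r.
    by rewrite mul0r; exact: cvg_cst.
  rewrite mul0r -[X in _ --> X](mulr0 f@_m); apply: cvgMl_tmp.
  rewrite -[X in _ --> X](mul0r (torus_char ex (linpt init_mx s) m)); apply: cvgM => //.
  by apply: pexp_lim; rewrite subr_gt0 lt_neqAle eq_sym um m0min.
have F_eq0 : \forall k \near \oo, F k = 0.
  apply: filterS phi_neq0 => k phi0.
  have w0 t : w k t != 0 by rewrite wE mulf_neq0.
  have := I_vanish (w k) w0 (ex_intro _ _ erefl) f If.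
  rewrite /ga_eval => /(congr1 ( *%R (pexp k (- u m0)))).
  rewrite mulr0 mulr_sumr => <-; apply: eq_bigr => m _.
  by rewrite charE pexpD [RHS]mulrCA -mulrA [X in _ = _ * X]mulrCA.
exact: (cvg_unique (@norm_hausdorff _ K) F_lim (cvg_near_cst 0 F_eq0)).
Qed.

Lemma init_ideal_vanish (I : set (groupalg K M)) :
  (forall w, (forall t, w t != 0) -> (exists s, w = linpt C s) ->
     forall f, I f -> ga_eval (torus_char ex w) f = 0) ->
  forall s, (forall t, linpt init_mx s t != 0) ->
  forall f, init_ideal u I f -> ga_eval (torus_char ex (linpt init_mx s)) f = 0.
Proof.
move=> I_vanish s s0; apply: ideal_gen_min.
  by apply: ga_eval_kernel_ideal; exact: torus_charD.
by move=> _ [f If <-]; exact: (init_form_eval_eq0 I_vanish s0 If).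
Qed.

End InitialDegeneration.

(** * Matroids of configurations *)

Section RealizedMatroids.
Variables (K : fieldType) (n : nat).
Implicit Types (Phi : set 'rV[K]_n) (M : {set {set 'I_n}}) (B F : {set 'I_n}).
Implicit Types (C : 'M[K]_n) (a w : 'rV[K]_n) (W : {vspace 'rV[K]_n}).

(* [C] expresses the coordinates of the space of solutions of the linear     *)
(* forms [Phi] through the coordinates in the basis [B].                     *)
Definition basis_mx Phi M B C :=
  [/\ forall i b, C i b != 0 -> b \in B,
      forall b b', b \in B -> C b b' = (b == b')%:R,
      forall a b, Phi a -> \sum_i a 0 i * C i b = 0,
      forall i, Phi (delta_mx 0 i - row i C) &
      forall i b, i \notin B -> C i b != 0 -> (i |: B :\ b)%SET \in M].

(** This interface lets W and its orthogonal complement, with dual matroids, be treated by the same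
    arguments. *)
Definition realizes Phi M := forall B, B \in M -> exists C, basis_mx Phi M B C.

Lemma mrank_max M (S : {set 'I_n}) : M != finset.set0 ->
  exists2 B, B \in M & mrank M S = #|B :&: S|.
Proof. by rewrite -card_gt0 => /(eq_bigmax_cond (fun B => #|B :&: S|))[B MB e]; exists B; rewrite // /mrank e. Qed.

Lemma leq_mrank M B (S : {set 'I_n}) : B \in M -> (#|B :&: S| <= mrank M S)%N.
Proof. exact: (@leq_bigmax_cond _ (mem M) (fun B => #|B :&: S|)). Qed.

(** A form supported on [i |: F] and nonzero at [i] allows [i] to be exchanged for an element of
    [F], so adding [i] does not raise the rank. Conversely, expanding coordinate [i] in a basis that
    is optimal for [F] must involve some [b] outside [F], and exchanging [b] for [i] raises the
    rank. *)
Lemma realizes_flatP Phi M F : realizes Phi M -> M != finset.set0 ->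
  is_flat M F <-> (forall i a, i \notin F -> Phi a ->
     (forall j, a 0 j != 0 -> j \in i |: F) -> a 0 i = 0).
Proof.
move=> real M0; split=> [F_flat i a iF Phia supp|F_closed].
  apply/eqP/negPn/negP => ai.
  move: F_flat => /forallP/(_ i)/implyP/(_ iF); rewrite ltnNge => /negP; apply.
  have [B MB ->] := mrank_max (i |: F) M0.
  have [iB|iB] := boolP (i \in B); last first.
    rewrite (leq_trans _ (leq_mrank F MB))// subset_leq_card//.
    apply/fintype.subsetP => j; rewrite !inE => /andP[jB] /orP[/eqP ji|->]; last by rewrite jB.
    by rewrite -ji jB in iB.
  have [C [C_supp C_delta C_orth _ C_exch]] := real B MB.
  (* Otherwise pairing [a] with column [i] of [C] would leave only the term [a 0 i]. *)
  have [j jF Cji] : exists2 j, j \in F :\: B & C j i != 0.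
    apply/exists_inP/contraT => /exists_inPn no; case/negP: ai.
    have := C_orth a i Phia; rewrite (bigD1 i)//= C_delta// eqxx mulr1 big1 ?addr0 => [->//|j ji].
    have [/supp|/negPn/eqP ->] := boolP (a 0 j != 0); last by rewrite mul0r.
    rewrite !inE (negbTE ji)/= => jF; have [jB|jB] := boolP (j \in B).
      by rewrite C_delta// (negbTE ji) mulr0.
    by have /no/negPn/eqP -> : j \in F :\: B; rewrite ?mulr0 // inE jB.
  move: jF; rewrite inE => /andP[jB jF].
  apply: (leq_trans _ (leq_mrank F (C_exch j i jB Cji))).
  have -> : B :&: (i |: F) = i |: (B :&: F).
    by apply/setP => k; rewrite !inE; case: eqP => // ->; rewrite iB.
  have -> : (j |: B :\ i) :&: F = j |: (B :&: F).
    apply/setP => k; rewrite !inE; case: (k =P j) => [->|_] /=; first by rewrite jF.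
    by case: (k =P i) => [->|]; rewrite //= (negbTE iF) andbF.
  by rewrite !cardsU1 !inE (negbTE iF) (negbTE jB) /= andbF.
apply/forallP => i; apply/implyP => iF.
have [B MB ->] := mrank_max F M0.
have [iB|iB] := boolP (i \in B).
  apply: leq_trans (leq_mrank (i |: F) MB).
  have -> : B :&: (i |: F) = i |: (B :&: F).
    by apply/setP => k; rewrite !inE; case: eqP => // ->; rewrite iB.
  by rewrite cardsU1 !inE (negbTE iF) andbF.
have [C [C_supp C_delta C_orth C_form C_exch]] := real B MB.
have Cii : C i i = 0 by apply/eqP/negPn/negP => /C_supp; rewrite (negbTE iB).
have [b bBF Cib] : exists2 b, b \notin F & C i b != 0.
  apply/exists_inP/contraT => /exists_inPn no.
  suff : (delta_mx 0 i - row i C) 0 i = 0.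
    by rewrite !mxE !eqxx Cii subr0 => /eqP; rewrite oner_eq0.
  apply: F_closed => // j; rewrite !mxE !inE eqxx /=; case: (j =P i) => //= _.
  rewrite sub0r oppr_eq0; apply: contraNT => jF.
  by have /no/negPn : j \notin F by [].
have bB := C_supp _ _ Cib.
apply: (leq_trans _ (leq_mrank (i |: F) (C_exch i b iB Cib))).
have -> : (i |: B :\ b) :&: (i |: F) = i |: (B :&: F).
  apply/setP => k; rewrite !inE; case: (k =P i) => //= _.
  by case: (k =P b) => [->|]; rewrite //= (negbTE bBF) andbF.
by rewrite cardsU1 !inE (negbTE iF) andbF.
Qed.

Lemma restrE B w k : restr K B w 0 k = w 0 (enum_val k).
Proof. by rewrite lfunE /= mxE. Qed.

Lemma config_matroidP W B : reflect
  ((forall w, w \in W -> (forall b, b \in B -> w 0 b = 0) -> w = 0) /\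
   (forall b, b \in B -> exists2 w, w \in W &
      forall b', b' \in B -> w 0 b' = (b == b')%:R))
  (B \in config_matroid W).
Proof.
rewrite inE; apply: (iffP andP) => -[].
  move=> /eqP ker0 /eqP img; split=> [w Ww w0|b bB].
    apply/eqP; rewrite -memv0 -ker0 memv_cap Ww andbT memv_ker.
    by apply/eqP/rowP => k; rewrite restrE mxE w0// enum_valP.
  have : delta_mx 0 (enum_rank_in bB b) \in (restr K B @: W)%VS by rewrite img memvf.
  move=> /memv_imgP[w Ww e]; exists w => // b' b'B.
  rewrite -[X in w 0 X](enum_rankK_in bB)// -restrE -e mxE eqxx /= eq_sym.
  suff -> : (enum_rank_in bB b == enum_rank_in bB b') = (b == b') by [].
  by rewrite -(inj_eq enum_val_inj) !enum_rankK_in.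
move=> inj surj; split.
  rewrite -subv0; apply/subvP => w; rewrite memv_cap memv_ker memv0 => /andP[/eqP w0 Ww].
  apply/eqP/inj => // b bB; rewrite -(enum_rankK_in bB bB) -restrE.
  by rewrite w0 mxE.
rewrite eqEsubv subvf; apply/subvP => v _.
rewrite (row_sum_delta v); apply: memv_suml => k _; apply: memvZ.
have [w Ww wk] := surj _ (enum_valP k).
apply/memv_imgP; exists w => //; apply/rowP => l.
by rewrite restrE mxE wk ?enum_valP// eqxx eq_sym (inj_eq enum_val_inj).
Qed.

(** The columns of [C] indexed by [B] form the basis of W dual to the coordinates in [B]; a nonzero
    entry of [C] is a pivot for a basis exchange. *)
Lemma config_basis_mx W B : B \in config_matroid W -> exists C,
  [/\ forall i b, C i b != 0 -> b \in B,
      forall b b', b \in B -> C b b' = (b == b')%:R,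
      forall b, b \in B -> \row_i C i b \in W,
      forall w i, w \in W -> w 0 i = \sum_b C i b * w 0 b &
      forall i b, i \notin B -> C i b != 0 -> (i |: B :\ b)%SET \in config_matroid W].
Proof.
move=> /config_matroidP[inj surj].
have /choice[v vP] (b : 'I_n) : exists v : 'rV[K]_n, b \in B ->
    v \in W /\ forall b', b' \in B -> v 0 b' = (b == b')%:R.
  have [bB|bB] := boolP (b \in B); last by exists 0.
  by have [v Wv vb] := surj b bB; exists v.
pose C := \matrix_(i, b) if b \in B then v b 0 i else 0.
have CE i b : b \in B -> C i b = v b 0 i by move=> bB; rewrite mxE bB.
have C_supp i b : C i b != 0 -> b \in B by rewrite mxE; case: ifP => //; rewrite eqxx.
have C_delta b b' : b \in B -> C b b' = (b == b')%:R.
  move=> bB; have [b'B|b'B] := boolP (b' \in B).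
    by rewrite CE//; have [_ ->] := vP b' b'B; rewrite // eq_sym.
  by rewrite mxE (negbTE b'B); case: eqP => // e; rewrite -e bB in b'B.
have C_col b : b \in B -> \row_i C i b \in W.
  move=> bB; have -> : \row_i C i b = v b by apply/rowP => i; rewrite mxE CE.
  by have [] := vP b bB.
have C_out i b : b \notin B -> C i b = 0 by move=> /negbTE bB; rewrite mxE bB.
clearbody C; have C_exp w i : w \in W -> w 0 i = \sum_b C i b * w 0 b.
  move=> Ww; suff /rowP/(_ i) : w - \sum_(b in B) w 0 b *: \row_j C j b = 0.
    rewrite !mxE summxE => /eqP; rewrite subr_eq0 => /eqP ->.
    rewrite [RHS](bigID (mem B))/= [X in _ + X]big1 ?addr0 => [|b bB].
      by apply: eq_bigr => b _; rewrite !mxE mulrC.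
    by rewrite C_out ?mul0r.
  apply: inj => [|b bB].
    by rewrite memvB// memv_suml// => b bB; rewrite memvZ// C_col.
  rewrite !mxE summxE (bigD1 b)//= big1 => [|b' /andP[_ b'b]].
    by rewrite !mxE C_delta// eqxx mulr1 addr0 subrr.
  by rewrite !mxE C_delta// eq_sym (negbTE b'b) mulr0.
exists C; split=> // i b iB Cib; have bB := C_supp _ _ Cib.
apply/config_matroidP; split=> [w Ww w0|b'].
  apply: inj => // b' b'B; have [->|b'b] := eqVneq b' b; last first.
    by apply: w0; rewrite !inE b'b b'B orbT.
  have := C_exp w i Ww; rewrite w0 ?inE ?eqxx// (bigD1 b)//= big1 => [|j jb].
    by rewrite addr0 => /esym/eqP; rewrite mulf_eq0 (negbTE Cib) => /eqP.
  have [jB|jB] := boolP (j \in B); first by rewrite (w0 j) ?mulr0// !inE jb jB orbT.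
  by rewrite C_out ?mul0r.
(* Pivoting on [C i b]: column [b] is scaled to have entry 1 at [i], and its multiples clear the
   entries at [i] of the other columns. *)
rewrite !inE => /orP[/eqP ->|/andP[b'b b'B]].
  exists ((C i b)^-1 *: \row_j C j b); first by rewrite memvZ// C_col.
  move=> b''; rewrite !inE => /orP[/eqP ->|/andP[b''b b''B]].
    by rewrite !mxE eqxx mulVf.
  rewrite !mxE (C_delta b'')// (negbTE b''b) mulr0.
  by case: eqP => // e; rewrite e b''B in iB.
exists (\row_j C j b' - C i b' / C i b *: \row_j C j b).
  by rewrite memvB ?memvZ ?C_col.
move=> b''; rewrite !inE => /orP[/eqP ->|/andP[b''b b''B]].
  have -> : (\row_j C j b' - C i b' / C i b *: \row_j C j b) 0 i =
            C i b' - C i b' / C i b * C i b by rewrite !mxE.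
  rewrite divfK// subrr; case: eqP => // e; by rewrite -e b'B in iB.
have -> : (\row_j C j b' - C i b' / C i b *: \row_j C j b) 0 b'' =
          C b'' b' - C i b' / C i b * C b'' b by rewrite !mxE.
by rewrite !(C_delta b'')// (negbTE b''b) mulr0 subr0 eq_sym.
Qed.

Definition orth W : set 'rV[K]_n :=
  [set a | forall w, w \in W -> \sum_i a 0 i * w 0 i = 0].

Lemma realizes_config W : realizes (orth W) (config_matroid W).
Proof.
move=> B /config_basis_mx[C [C_supp C_delta C_col C_exp C_exch]].
exists C; split=> // [a b /= aW|i w Ww].
  have [bB|bB] := boolP (b \in B).
    rewrite -[RHS](aW _ (C_col b bB)).
    by apply: eq_bigr => i _; rewrite mxE.
  rewrite big1// => i _; have [->|/C_supp] := eqVneq (C i b) 0; first by rewrite mulr0.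
  by rewrite (negbTE bB).
under eq_bigr do rewrite !mxE eqxx mulrBl /=.
rewrite sumrB -C_exp// (bigD1 i)//= eqxx mul1r big1 ?addr0 ?subrr// => j /negbTE ->.
by rewrite mul0r.
Qed.

(** The vectors of W are the equations of the orthogonal complement. Its coordinates outside [B] are
    free, and pairing with column [i] of [C] solves for coordinate [i] in [B], so the matrix is
    minus the transpose of [C] on that block. *)
Lemma realizes_dual_config W :
  realizes [set v | v \in W] (dual_matroid (config_matroid W)).
Proof.
move=> _ /imsetP[B MB ->].
have [C [C_supp C_delta C_col C_exp C_exch]] := config_basis_mx MB.
exists (\matrix_(i, b) if b \in B then 0 else if i \in B then - C b i else (i == b)%:R).
split=> [i b|b b'|v b /= Wv|i|i b].
- by rewrite mxE inE; case: ifP => //; rewrite eqxx.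
- rewrite inE mxE => bB; rewrite (negbTE bB); case: ifP => // b'B.
  by case: eqP => // e; rewrite e b'B in bB.
- have [bB|bB] := boolP (b \in B); first by rewrite big1// => i _; rewrite mxE bB mulr0.
  rewrite (bigID (mem B))/= [X in X + _](_ : _ = - v 0 b).
    rewrite (bigD1 b)//= mxE (negbTE bB) eqxx mulr1 big1 ?addr0 ?addNr// => i /andP[iB ib].
    by rewrite mxE (negbTE bB) (negbTE iB) (negbTE ib) mulr0.
  rewrite (C_exp v b Wv) -sumrN [RHS](bigID (mem B))/= [X in _ = _ + X]big1 ?addr0 => [|i iB].
    by apply: eq_bigr => i iB; rewrite mxE (negbTE bB) iB mulrN mulrC.
  by have [->|/C_supp] := eqVneq (C b i) 0; rewrite ?mul0r ?oppr0// (negbTE iB).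
- have [iB|iB] := boolP (i \in B).
    rewrite [X in _ X](_ : _ = \row_j C j i); first exact: C_col.
    apply/rowP => j; rewrite !mxE eqxx /= iB.
    have [jB|jB] := boolP (j \in B); first by rewrite subr0 C_delta// eq_sym.
    by rewrite opprK; case: eqP => [e|]; rewrite ?add0r//; rewrite e iB in jB.
  rewrite [X in _ X](_ : _ = 0); first exact: mem0v.
  apply/rowP => j; rewrite !mxE eqxx /= (negbTE iB) eq_sym.
  by have [jB|jB] := boolP (j \in B); rewrite ?subrr// subr0; case: eqP => // e; rewrite e jB in iB.
- rewrite inE negbK mxE => iB; rewrite iB; case: ifP => [|/negbT bB]; first by rewrite eqxx.
  rewrite oppr_eq0 => Cbi; apply/imsetP; exists (b |: B :\ i)%SET; first exact: C_exch.
  apply/setP => j; rewrite !inE negb_or negb_and negbK.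
  case: (j =P i) => [->|_]; first by case: eqP => // e; rewrite -e iB in bB.
  by rewrite /=.
Qed.

End RealizedMatroids.

(** * Bergman fans *)

Lemma sorted_proper_last (T : finType) (s : seq {set T}) :
  sorted (fun F G : {set T} => F \proper G) s ->
  (s = [::] \/ last finset.set0 s \in s) /\
  forall F, F \in s -> F \subset last finset.set0 s.
Proof.
have tr : transitive (fun F G : {set T} => F \proper G).
  by move=> G F H; exact: proper_trans.
elim/last_ind: s => [|s G _]; first by split; [left|].
rewrite sorted_pairwise// pairwise_rcons last_rcons => /andP[/allP sG _]; split.
  by right; rewrite mem_rcons inE eqxx.
by move=> F; rewrite mem_rcons inE => /orP[/eqP ->|/sG/proper_sub].
Qed.

Section SuperlevelFlag.
Variables (R : realType) (n : nat).
Implicit Types (u : 'rV[R]_n).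

Definition superlevel u (i : 'I_n) : {set 'I_n} := [set j | u 0 i < u 0 j]%SET.

Lemma in_superlevel u i j : (j \in superlevel u i) = (u 0 i < u 0 j).
Proof. by rewrite inE. Qed.

(** Induction that merges the two lowest values of [u]: this removes the largest superlevel set [G],
    which is put back at the end of the flag. *)
Lemma superlevel_flag u : exists (s : seq {set 'I_n}),
  [/\ sorted (fun F G : {set 'I_n} => F \proper G) s,
      forall F, F \in s -> F != finset.set0 /\ exists i, F = superlevel u i &
      flag_cone s u].
Proof.
have [k] := ubnP (\max_i #|superlevel u i|)%N; elim: k u => // k IH u.
rewrite ltnS => le_k.
have [i _|no] := pickP (xpredT : pred 'I_n); last first.
  exists [::]; split=> //; exists 0, (fun=> 0); split=> //.
  by apply/rowP => i; have := no i.
have [i0 _ i0min] := arg_minP (fun j => u 0 j) (isT : xpredT i).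
have [G GE] : exists G, G = superlevel u i0 by exists (superlevel u i0).
have inG j : (j \in G) = (u 0 i0 < u 0 j) by rewrite GE in_superlevel.
have notG j : j \notin G -> u 0 j = u 0 i0.
  by rewrite inG -leNgt => ju; apply/le_anti; rewrite ju i0min.
have [G0|/set0Pn[g Gg]] := eqVneq G finset.set0.
  exists [::]; split=> //; exists (u 0 i0), (fun=> 0); split=> //.
  by apply/rowP => j; rewrite big_nil addr0 !mxE !inE mulr1 notG// G0 inE.
have [i1 Gi1 i1min] := arg_minP (fun j => u 0 j) Gg.
pose d := u 0 i1 - u 0 i0.
have d_gt0 : 0 < d by rewrite subr_gt0 -inG.
(* The lowest value is raised to the next one, [u 0 i1]. *)
pose v := \row_j (if j \in G then u 0 j else u 0 i1).
have vE j : v 0 j = if j \in G then u 0 j else u 0 i1 by rewrite mxE.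
have lvl_v i' : exists2 i'', i'' \in G & superlevel v i' = superlevel u i''.
  exists (if i' \in G then i' else i1); first by case: ifP.
  apply/setP => j; rewrite !in_superlevel !vE.
  have i1i' : u 0 i1 <= u 0 (if i' \in G then i' else i1) by case: ifP => // /i1min.
  have -> : (if i' \in G then u 0 i' else u 0 i1) = u 0 (if i' \in G then i' else i1).
    by case: ifP.
  have [jG|jG] := boolP (j \in G); first by [].
  by rewrite (notG j jG) !ltNge i1i' i0min.
have lvl_proper i' : i' \in G -> superlevel u i' \proper G.
  move=> Gi'; apply/properP; split; last by exists i'; rewrite // in_superlevel ltxx.
  apply/fintype.subsetP => j; rewrite in_superlevel inG; apply: le_lt_trans; exact: i0min.
have [|s [s_sorted s_lvl [c [a [a_ge0 vE']]]]] := IH v.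
  apply: leq_trans le_k; apply: leq_trans (leq_bigmax i0); rewrite -GE.
  have G_gt0 : (0 < #|G|)%N by apply/card_gt0P; exists g.
  rewrite -(prednK G_gt0) ltnS; apply/bigmax_leqP => /= i' _.
  have [i'' Gi'' ->] := lvl_v i'.
  by rewrite -ltnS (prednK G_gt0); exact/proper_card/lvl_proper.
have s_proper F : F \in s -> F \proper G.
  by move=> /s_lvl[_ [i' ->]]; have [i'' Gi'' ->] := lvl_v i'; exact: lvl_proper.
exists (rcons s G); split.
- case: s s_sorted s_proper {s_lvl a_ge0 vE'} => //= F s s_sorted s_proper.
  by rewrite rcons_path s_sorted s_proper// mem_last.
- move=> F; rewrite mem_rcons inE => /orP[/eqP ->|/s_lvl[F0 [i' Fi']]].
    by split; [apply/set0Pn; exists g|exists i0; rewrite GE].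
  by split=> //; rewrite Fi'; have [i'' _ ->] := lvl_v i'; exists i''.
(* [v] exceeds [u] by [d] outside [G], so [u] is [v] minus [d] times the all-ones vector plus [d]
   times the indicator of [G]. *)
exists (c - d), (fun F => if F == G then d else a F); split=> [F|].
  rewrite mem_rcons inE; case: eqP => [_ _|_ /= /a_ge0//]; exact: ltW.
rewrite -cats1 big_cat big_seq1 eqxx /=.
have -> : \sum_(F <- s) (if F == G then d else a F) *: evec R F = \sum_(F <- s) a F *: evec R F.
  rewrite big_seq [RHS]big_seq; apply: eq_bigr => F /s_proper FG.
  by rewrite (negbTE (proper_neq FG)).
apply/rowP => j; have := congr1 (fun w : 'rV_n => w 0 j) vE'.
rewrite vE !mxE finset.in_setT /d.
by have [_|/notG ->] := boolP (j \in G); rewrite /=; lra.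
Qed.

End SuperlevelFlag.

Section BergmanSupport.
Variables (K : fieldType) (R : realType) (n : nat).
Variables (Phi : set 'rV[K]_n) (M : {set {set 'I_n}}).
Hypothesis real : realizes Phi M.
Hypothesis M_neq0 : M != finset.set0.
Hypothesis loopless : forall i : 'I_n, ~ is_loop M i.
Implicit Types (u : 'rV[R]_n).

(** The defining condition of a tropical linear space: no form in [Phi] attains its minimum exactly
    once. *)
Definition no_isolated_min u := forall a i, Phi a -> a 0 i != 0 ->
  exists j, [/\ j != i, a 0 j != 0 & u 0 j <= u 0 i].

Lemma loopless_flat0 : is_flat M finset.set0.
Proof.
apply/(realizes_flatP _ real M_neq0) => i a _ Phia supp.
have [B MB iB] : exists2 B, B \in M & i \in B.
  apply: contrapT => no; case: (loopless (i := i)) => B MB; apply/negP => iB.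
  by apply: no; exists B.
have [C [_ C_delta C_orth _ _]] := real MB.
have := C_orth a i Phia; rewrite (bigD1 i)//= C_delta// eqxx mulr1 big1 ?addr0// => j ji.
by have [->|/supp] := eqVneq (a 0 j) 0; rewrite ?mul0r// !inE (negbTE ji).
Qed.

Lemma bergman_supportP u :
  (exists2 s, is_flag_of_flats M s & flag_cone s u) <-> no_isolated_min u.
Proof.
split=> [[s /andP[s_sorted /allP s_flat] [c [x [x_ge0 uE]]]] a i Phia ai|iso].
  apply: contrapT => no.
  have above j : j != i -> a 0 j != 0 -> u 0 i < u 0 j.
    by move=> ji aj; rewrite ltNge; apply/negP => ju; apply: no; exists j.
  (* The last flat missing [i] contains every [j] with [u 0 i < u 0 j], since some flat of the flag
     contains [j] but not [i]. The default of [last] is the empty set, a flat by looplessness. *)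
  pose r := [seq F : {set 'I_n} <- s | i \notin F].
  have r_sorted : sorted (fun F G : {set 'I_n} => F \proper G) r.
    by apply: sorted_filter => // G F H; exact: proper_trans.
  have [r_last r_max] := sorted_proper_last r_sorted.
  set F := last finset.set0 r in r_last r_max.
  have [F_flat iF] : is_flat M F /\ i \notin F.
    case: r_last => [r0|]; first by rewrite /F r0; split; [exact: loopless_flat0|rewrite inE].
    by rewrite mem_filter => /andP[iF /s_flat/and3P[]].
  case/negP: ai; apply/eqP.
  apply: ((realizes_flatP _ real M_neq0).1 F_flat) => // j aj; rewrite !inE.
  case: (eqVneq j i) => //= ji.
  suff [G sG /andP[jG iG]] : exists2 G, G \in s & (j \in G) && (i \notin G).
    by apply: (fintype.subsetP (r_max G _)) => //; rewrite mem_filter iG.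
  apply/hasP/contraT => /hasPn none; have := above j ji aj; rewrite ltNge => /negP[].
  rewrite uE !mxE !inE !summxE lerD2l big_seq [leRHS]big_seq ler_sum// => G sG.
  rewrite !mxE ler_wpM2l ?x_ge0// ler_nat.
  by have := none G sG; case: (j \in G) => //=; rewrite negbK => ->.
have [s [s_sorted s_lvl u_s]] := superlevel_flag u.
exists s => //; apply/andP; split=> //; apply/allP => F sF.
have [F0 [i FE]] := s_lvl F sF; apply/and3P; split=> //; last first.
  apply/negP => /eqP FT; have : i \in F by rewrite FT finset.in_setT.
  by rewrite FE in_superlevel ltxx.
apply/(realizes_flatP _ real M_neq0) => k a kF Phia supp; apply/eqP/negPn/negP => ak.
have [j [jk aj juk]] := iso a k Phia ak.
have := supp j aj; rewrite !inE (negbTE jk) FE in_superlevel /= => uij.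
by move: kF; rewrite FE in_superlevel -leNgt leNgt (lt_le_trans uij juk).
Qed.

(** For a basis of maximal weight, exchange shows that coordinate [i] expands only through
    coordinates at least as heavy. The absence of isolated minima makes one of them equally heavy,
    so truncation to equal weights leaves no zero row. *)
Lemma optimal_basis_mx u : no_isolated_min u -> exists B C,
  [/\ B \in M, basis_mx Phi M B C, forall i b, C i b != 0 -> u 0 i <= u 0 b &
      forall i, exists b, C i b != 0 /\ u 0 i = u 0 b].
Proof.
move=> iso; have [B0 MB0] : exists B, B \in M by exact/finset.set0Pn.
have [B MB Bmax] := arg_maxP (fun B : {set 'I_n} => \sum_(i in B) u 0 i) MB0.
have [C CP] := real MB; have [C_supp C_delta C_orth C_form C_exch] := CP.
have C_le i b : C i b != 0 -> u 0 i <= u 0 b.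
  move=> Cib; have bB := C_supp _ _ Cib; have [iB|iB] := boolP (i \in B).
    by move: Cib; rewrite C_delta//; case: (i =P b) => [->//|_]; rewrite eqxx.
  have := Bmax _ (C_exch i b iB Cib).
  rewrite big_setU1/=; last by rewrite !inE (negbTE iB) andbF.
  by rewrite [leRHS](big_setD1 b)//= lerD2r.
exists B, C; split=> // i; have [iB|iB] := boolP (i \in B).
  by exists i; rewrite C_delta// eqxx oner_eq0.
have Cii : C i i = 0 by apply/eqP/negPn/negP => /C_supp; rewrite (negbTE iB).
have [|j [ji]] := iso _ i (C_form i); first by rewrite !mxE !eqxx Cii subr0 oner_eq0.
rewrite !mxE eqxx (negbTE ji) /= sub0r oppr_eq0 => Cij uji.
by exists j; split=> //; apply/le_anti; rewrite C_le.
Qed.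

End BergmanSupport.

(** * The ideal of Lambda_W *)

Section LambdaTorus.
Variables (K : numFieldType) (R : realType) (n : nat) (W : {vspace 'rV[K]_n}).
Variable p : 'rV[R]_n * 'rV[R]_n.

Local Notation T := ('I_n + 'I_n)%type.
Local Notation Gamma := (charlat n * charlat n)%type.
Local Notation Q := (init_ideal (torus_pairing p) (Lambda_ideal W)).
Local Notation gen a e := (\sum_j << a j *g e j >> : groupalg K Gamma).

(* The exponents of [w] and of [gamma = beta * w], in which the equations of *)
(* Lambda_W become linear: [w] lies in W and [gamma] annihilates W.          *)
Definition lexp (m : Gamma) (t : T) : int :=
  match t with
  | inl i => char_val m.1 0 i - char_val m.2 0 i
  | inr i => char_val m.2 0 i
  end.

(** Quotients of coordinates [w] or of coordinates [gamma]. A quotient across the two blocks does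
    not have bidegree zero; there 0 is a default value. *)
Definition lratio (b t : T) : Gamma :=
  match b, t with
  | inl i, inl j => (char_ratio i j, 0)
  | inr i, inr j => (char_ratio i j, char_ratio i j)
  | _, _ => 0
  end.

(** [gamma_i] is [beta_i * w_i], and [beta_i] has weight [- p.2 0 i] by the identification of
    cocharacters. *)
Definition lweight (t : T) : R :=
  match t with inl i => p.1 0 i | inr i => (p.1 - p.2) 0 i end.

Definition same_block (b t : T) : bool :=
  match b, t with inl _, inl _ | inr _, inr _ => true | _, _ => false end.

Lemma lexpD a b t : lexp (a + b) t = lexp a t + lexp b t.
Proof. by case: t => i /=; rewrite !mxE// opprD addrACA. Qed.

Lemma lexp_eq0 a : (forall t, lexp a t = 0) -> a = 0.
Proof.
case: a => a1 a2 a0.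
have a20 : a2 = 0 by apply/val_inj/rowP => i; rewrite [RHS]mxE; exact: (a0 (inr i)).
rewrite a20 in a0 *; congr pair; apply/val_inj/rowP => i.
by rewrite [RHS]mxE; have := a0 (inl i); rewrite /= !mxE subr0.
Qed.

Lemma lexp_ratio b t s : same_block b t ->
  lexp (lratio b t) s = (s == b)%:R - (s == t)%:R.
Proof.
by case: b t s => [b|b] [t|t] [s|s] //= _; rewrite !mxE /= ?subr0// subrr.
Qed.

Lemma lratio_inj (t : T) (iota : 'I_n -> T) : injective iota ->
  (forall i, same_block (iota i) t) -> injective (fun i => lratio (iota i) t).
Proof.
move=> iota_inj iota_t i j /(congr1 (lexp^~ (iota i))).
rewrite !lexp_ratio// eqxx => /addIr/eqP.
by case: (iota i =P iota j) => [/iota_inj|].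
Qed.

Lemma torus_pairing_lexp m :
  torus_pairing p m = \sum_t lweight t * (lexp m t)%:~R.
Proof.
rewrite big_sumType /= /torus_pairing -!big_split /=; apply: eq_bigr => i _.
by rewrite !mxE rmorphB /=; ring.
Qed.

Lemma torus_pairing_ratio b t : same_block b t ->
  torus_pairing p (lratio b t) = lweight b - lweight t.
Proof.
move=> bt; rewrite torus_pairing_lexp.
have e c : \sum_s lweight s * (s == c)%:R = lweight c.
  by rewrite (bigD1 c)//= eqxx mulr1 big1 ?addr0// => s /negbTE ->; rewrite mulr0.
rewrite -[in RHS](e b) -[in RHS](e t) -sumrB; apply: eq_bigr => s _.
by rewrite lexp_ratio// rmorphB /= -mulrBr !natz.
Qed.

Lemma torus_char_ratio (w : T -> K) b t : (forall t, w t != 0) -> same_block b t ->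
  torus_char lexp w (lratio b t) = w b / w t.
Proof.
move=> w0 bt; rewrite /torus_char.
have e c : \prod_s w s ^ ((s == c)%:R : int) = w c.
  rewrite (bigD1 c)//= eqxx expr1z big1 ?mulr1// => s /negbTE ->.
  by rewrite expr0z.
rewrite -[in RHS](e b) -[in RHS](e t) -prodfV -big_split /=; apply: eq_bigr => s _.
by rewrite lexp_ratio// expfzDr// -invr_expz.
Qed.

Lemma subspace_form a i : orth W a ->
  Lambda_ideal W (gen (a 0) (fun j => lratio (inl j) (inl i))).
Proof. by move=> aW; apply: sub_ideal_gen; left; exists a, i. Qed.

Lemma incidence_form v i : v \in W ->
  Lambda_ideal W (gen (v 0) (fun j => lratio (inr j) (inr i))).
Proof. by move=> vW; apply: sub_ideal_gen; right; exists v, i, i. Qed.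

Lemma init_linear_form (iota : 'I_n -> T) (a : 'I_n -> K) (i : 'I_n) : injective iota ->
  (forall j, same_block (iota j) (iota i)) ->
  Lambda_ideal W (gen a (fun j => lratio (iota j) (iota i))) ->
  a i != 0 -> (forall j, a j != 0 -> lweight (iota i) <= lweight (iota j)) ->
  Q (gen (fun j => if lweight (iota i) == lweight (iota j) then a j else 0)
         (fun j => lratio (iota j) (iota i))).
Proof.
move=> iota_inj iota_i Lf ai imin; apply: sub_ideal_gen.
exists (gen a (fun j => lratio (iota j) (iota i))); first exact: Lf.
have uE j : torus_pairing p (lratio (iota j) (iota i)) = lweight (iota j) - lweight (iota i).
  exact: torus_pairing_ratio.
have umin j : a j != 0 -> torus_pairing p (lratio (iota i) (iota i)) <=
    torus_pairing p (lratio (iota j) (iota i)).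
  by move=> aj; rewrite !uE lerD2r imin.
apply: etrans (init_form_linear (lratio_inj iota_inj iota_i) ai umin) _.
by apply: eq_bigr => j _; rewrite !uE (inj_eq (addIr _)) eq_sym.
Qed.

(** Supplies the relations [Q_lin] for [linear_ideal_prime]: coordinate [i] has least weight in its
    own expansion and so survives in the initial form. *)
Lemma init_basis_form (iota : 'I_n -> T) (C : 'M[K]_n) (i : 'I_n) : injective iota ->
  (forall j, same_block (iota j) (iota i)) -> C i i = 0 ->
  (forall j, C i j != 0 -> lweight (iota i) <= lweight (iota j)) ->
  Lambda_ideal W (gen ((delta_mx 0 i - row i C) 0) (fun j => lratio (iota j) (iota i))) ->
  Q (1 - gen (fun j => if lweight (iota i) == lweight (iota j) then C i j else 0)
             (fun j => lratio (iota j) (iota i))).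
Proof.
move=> iota_inj iota_i Cii C_le Lf.
have aE j : (delta_mx 0 i - row i C) 0 j = (j == i)%:R - C i j by rewrite !mxE.
have ai : (delta_mx 0 i - row i C) 0 i != 0 by rewrite aE eqxx Cii subr0 oner_eq0.
have amin j : (delta_mx 0 i - row i C) 0 j != 0 -> lweight (iota i) <= lweight (iota j).
  by rewrite aE; case: (j =P i) => [->//|_]; rewrite sub0r oppr_eq0; exact: C_le.
have := init_linear_form iota_inj iota_i Lf ai amin.
have lratio0 : lratio (iota i) (iota i) = 0.
  by apply: lexp_eq0 => t; rewrite lexp_ratio// subrr.
congr (Q _); rewrite ga_oneE -lratio0 -sumrN (bigD1 i)//= [in RHS](bigD1 i)//=.
rewrite eqxx Cii monalgU0 oppr0 add0r aE eqxx Cii subr0; congr (_ + _).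
apply: eq_bigr => j ji; rewrite aE (negbTE ji) sub0r.
by case: ifP => _; rewrite ?monalgUN// monalgU0 oppr0.
Qed.

Lemma eval_linear_form (iota : 'I_n -> T) (a : 'I_n -> K) (t : T) (w : T -> K) :
  (forall t, w t != 0) -> (forall i, same_block (iota i) t) ->
  ga_eval (torus_char lexp w) (gen a (fun j => lratio (iota j) t)) =
  (\sum_j a j * w (iota j)) / w t.
Proof.
move=> w0 iota_t; rewrite ga_eval_sum mulr_suml; apply: eq_bigr => j _.
by rewrite ga_evalU torus_char_ratio// mulrA.
Qed.

Lemma trop_no_isolated_min (iota : 'I_n -> T) (Phi : set 'rV[K]_n) (u : 'rV[R]_n) :
  injective iota -> (forall i j, same_block (iota i) (iota j)) ->
  (forall i, lweight (iota i) = u 0 i) ->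
  (forall a i, Phi a -> Lambda_ideal W (gen (a 0) (fun j => lratio (iota j) (iota i)))) ->
  Q <> [set: groupalg K Gamma] -> no_isolated_min Phi u.
Proof.
move=> iota_inj iota_bl iotaE Phi_form Q_proper a i Phia ai.
apply: contrapT => no; apply: Q_proper.
have above j : j != i -> a 0 j != 0 -> u 0 i < u 0 j.
  by move=> ji aj; rewrite ltNge; apply/negP => ju; apply: no; exists j.
have [_ _ QM] : is_ideal Q by exact: ideal_gen_ideal.
apply: ideal_full; first exact: ideal_gen_ideal.
have lratio0 : lratio (iota i) (iota i) = 0.
  by apply: lexp_eq0 => t; rewrite lexp_ratio// subrr.
(* Since the form is normalized by coordinate [i], its initial form is the constant [a 0 i], a
   unit. *)
have := init_linear_form iota_inj (iota_bl^~ i) (Phi_form a i Phia) ai.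
rewrite (bigD1 i)//= big1 => [|j ji].
  rewrite eqxx addr0 lratio0 => /(_ _)/(QM << (a 0 i)^-1 *g 0 >>).
  rewrite ga_mulU addr0 mulVf//; apply => j aj; rewrite !iotaE.
  by have [->//|/above/(_ aj)/ltW] := eqVneq j i.
rewrite !iotaE; have [->|aj] := eqVneq (a 0 j) 0; first by rewrite if_same monalgU0.
by rewrite (lt_eqF (above j ji aj)) monalgU0.
Qed.

Variable pexp : nat -> R -> K.
Hypothesis pexpD : forall k a b, pexp k (a + b) = pexp k a * pexp k b.
Hypothesis pexp_neq0 : forall k a, pexp k a != 0.
Hypothesis pexp_small : forall c e, 0 < c -> 0 < e ->
  exists N, forall k, (N <= k)%N -> `|pexp k c| < e.

Let M := config_matroid W.
Hypothesis M_neq0 : M != finset.set0.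
Hypothesis Md_neq0 : dual_matroid M != finset.set0.
Hypothesis iso_w : no_isolated_min (orth W) p.1.
Hypothesis iso_gamma : no_isolated_min [set v | v \in W] (p.1 - p.2).

Lemma init_ideal_Lambda_prime : is_prime_ideal Q.
Proof.
have [B1 [C1 [_ [C1_supp C1_delta C1_orth C1_form _] C1_le C1_row]]] :=
  optimal_basis_mx (@realizes_config _ _ W) M_neq0 iso_w.
have [B2 [C2 [_ [C2_supp C2_delta C2_orth C2_form _] C2_le C2_row]]] :=
  optimal_basis_mx (@realizes_dual_config _ _ W) Md_neq0 iso_gamma.
(* The two linear spaces are joined into one with a block-diagonal matrix. *)
pose B := [set t : T | match t with inl b => b \in B1 | inr b => b \in B2 end]%SET.
pose C (t b : T) : K := match t, b with
  | inl i, inl j => C1 i j | inr i, inr j => C2 i j | _, _ => 0 end.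
have C_le t b : C t b != 0 -> lweight t <= lweight b.
  by case: t b => [t|t] [b|b] /=; rewrite ?eqxx//; [exact: C1_le|exact: C2_le].
have C_block t b : init_mx C lweight t b != 0 -> same_block b t.
  by rewrite /init_mx; case: ifP => _; case: t b => [t|t] [b|b] //=; rewrite eqxx.
apply: (@linear_ideal_prime K _ _ lexp B (init_mx C lweight) lratio).
- exact: lexpD.
- exact: lexp_eq0.
- move=> t b; rewrite /init_mx inE; case: ifP => _; last by rewrite eqxx.
  by case: t b => [t|t] [b|b] /=; rewrite ?eqxx//; [exact: C1_supp|exact: C2_supp].
- move=> b b'; rewrite inE /init_mx => bB; case: eqP => [_|ne].
    by case: b b' bB => [b|b] [b'|b'] //= bB; [rewrite C1_delta|rewrite C2_delta].
  by case: eqP => // e; case: ne; rewrite e.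
- case=> i; rewrite /init_mx.
    by have [b [Cib ub]] := C1_row i; exists (inl b); rewrite /= ub eqxx.
  by have [b [Cib ub]] := C2_row i; exists (inr b); rewrite /= ub eqxx.
- by move=> t b /C_block bt s; exact: lexp_ratio.
- exact: ideal_gen_ideal.
- have other (F : 'I_n -> groupalg K Gamma) : (forall j, F j = 0) -> \sum_j F j = 0.
    by move=> F0; rewrite big1.
  case=> i; rewrite inE => iB; rewrite big_sumType /=.
    rewrite [X in - (_ + X)]other ?addr0 => [|j]; last by rewrite /init_mx /= if_same monalgU0.
    apply: (@init_basis_form inl C1) => //; first by move=> j k [].
    - by apply/eqP/negPn/negP => /C1_supp; rewrite (negbTE iB).
    - by move=> j; exact: C1_le.
    - by apply: subspace_form; exact: C1_form.
  rewrite [X in - (X + _)]other ?add0r => [|j]; last by rewrite /init_mx /= if_same monalgU0.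
  apply: (@init_basis_form inr C2) => //; first by move=> j k [].
  - by apply/eqP/negPn/negP => /C2_supp; rewrite (negbTE iB).
  - by move=> j; exact: C2_le.
  - by apply: incidence_form; exact: C2_form.
- apply: (init_ideal_vanish (ex := lexp) (C := C) (U := lweight) lexpD C_le torus_pairing_lexp
    pexpD pexp_neq0 pexp_small).
  move=> w w0 [s ws].
  have w_orth (iota : 'I_n -> T) (D : 'M[K]_n) a : (forall i, w (iota i) = \sum_b D i b * s (iota b)) ->
      (forall b, \sum_i a i * D i b = 0) -> \sum_i a i * w (iota i) = 0.
    move=> wD aD; under eq_bigr do rewrite wD mulr_sumr.
    rewrite exchange_big big1//= => b _; under eq_bigr do rewrite mulrA.
    by rewrite -mulr_suml aD mul0r.
  have wl i : w (inl i) = \sum_b C1 i b * s (inl b).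
    rewrite ws /linpt big_sumType /= [X in _ + X]big1 ?addr0// => j _.
    by rewrite mul0r.
  have wr i : w (inr i) = \sum_b C2 i b * s (inr b).
    rewrite ws /linpt big_sumType /= [X in X + _]big1 ?add0r// => j _.
    by rewrite mul0r.
  have chD := torus_charD lexpD w0.
  apply: ideal_gen_min; first exact: ga_eval_kernel_ideal.
  move=> f [[a [j [aW ->]]]|[v [j [k [vW ->]]]]] /=.
    rewrite (@eval_linear_form inl (a 0) (inl j))// (w_orth _ _ _ wl) ?mul0r// => b.
    exact: C1_orth.
  (* The incidence equation is divided by [w_j * beta_k]; extracting the factor [w_k / w_j] leaves a
     linear form in [gamma] divided by [gamma_k]. *)
  rewrite [X in ga_eval _ X](_ : _ = (<< 1 *g lratio (inl k) (inl j) >> : groupalg K Gamma) *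
      gen (v 0) (fun i => lratio (inr i) (inr k))).
    rewrite ga_evalM// (@eval_linear_form inr (v 0) (inr k))// (w_orth _ _ _ wr).
      by rewrite mul0r mulr0.
    by move=> b; exact: C2_orth.
  rewrite ga_mulU_sumr; apply: eq_bigr => i _; rewrite mul1r.
  suff -> : lratio (inl k) (inl j) + lratio (inr i) (inr k) =
    (char_ratio i j, char_ratio i k) by [].
  apply/eqP; rewrite -subr_eq0; apply/eqP/lexp_eq0 => -[l|l] /=; rewrite !mxE /=; ring.
Qed.

End LambdaTorus.

(** * Real powers of a null sequence of positive reals inside the complex numbers *)

Section ComplexExponential.
Variable R : realType.

(** The power [z_k ^ c] for [z_k = exp (- k)]. *)
Definition decay (k : nat) (c : R) : R[i] := (expR (- (k%:R * c)))%:C%C.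

Lemma decayD k a b : decay k (a + b) = decay k a * decay k b.
Proof. by rewrite /decay -rmorphM /= -expRD mulrDr opprD. Qed.

Lemma decay_neq0 k a : decay k a != 0.
Proof. by rewrite /decay fmorph_eq0 expR_eq0. Qed.

Lemma decay_small (c : R) (e : R[i]) : 0 < c -> 0 < e ->
  exists N, forall k, (N <= k)%N -> `|decay k c| < e.
Proof.
case: e => er ei c0; rewrite ltcE /= => /andP[/eqP -> er0].
have cN : (c * er)^-1 < (Num.bound (c * er)^-1)%:R.
  by rewrite archi_boundP// invr_ge0 mulr_ge0// ltW.
exists (Num.bound (c * er)^-1) => k Nk.
(* This suffices because [exp x >= 1 + x]. *)
have ck : 1 < er * (k%:R * c).
  rewrite mulrCA [er * c]mulrC -ltr_pdivrMr ?mulr_gt0// div1r.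
  by rewrite (lt_le_trans cN)// ler_nat.
rewrite /decay normc_def /= expr0n addr0 sqrtr_sqr ger0_norm ?expR_ge0//.
rewrite ltcE /= eqxx /= expRN invf_plt ?posrE ?expR_gt0//.
rewrite (lt_le_trans _ (expR_ge1Dx _))// -div1r ltr_pdivrMr//.
by rewrite mulrDl mul1r [X in _ + X]mulrC ltr_wpDl// ltW.
Qed.

End ComplexExponential.

(** * The support of the fan of M and its comparison with the tropicalization *)

Lemma Delta_fan_supportP (R : realType) n (M : {set {set 'I_n}}) (p : 'rV[R]_n * 'rV[R]_n) :
  fan_support (@Delta_fan R n M) p <->
  (exists2 s, is_flag_of_flats M s & flag_cone s p.1) /\
  (exists2 s, is_flag_of_flats (dual_matroid M) s & flag_cone s (p.1 - p.2)).
Proof.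
split.
  move=> [_ [_ [_ [_ [s s_flag <-] <-] [_ [t t_flag <-] <-]] <-]].
  move=> [[x y] [[x' x's /= xE] yt] <-] /=; split.
    by exists s => //; rewrite -xE opprK.
  by exists t => //; rewrite opprK addKr.
move=> [[s s_flag ps] [t t_flag pt]].
exists ((fun q => - mu q) @` ((-%R @` flag_cone s) `*` flag_cone t)); last first.
  (* The preimage of [p] under [- mu]. *)
  exists (- p.1, p.1 - p.2); first by split=> //=; exists p.1.
  by rewrite [RHS]surjective_pairing /mu /= addKr; congr pair; rewrite opprK.
exists ((-%R @` flag_cone s) `*` flag_cone t) => //.
exists (-%R @` flag_cone s); first by exists (flag_cone s) => //; exists s.
by exists (flag_cone t) => //; exists t.
Qed.


Theorem proposition4p11 (R : realType) (n : nat) (W : {vspace 'rV[R[i]]_n})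
    (hdim : (0 < \dim W < n)%N)
    (hloop : forall i : 'I_n, ~ is_loop (config_matroid W) i)
    (hcoloop : forall i : 'I_n, ~ is_coloop (config_matroid W) i) :
  trop (@torus_pairing R n) (Lambda_ideal W)
    = fan_support (@Delta_fan R n (config_matroid W)) /\
  (forall p : 'rV[R]_n * 'rV[R]_n,
     is_regular_point (trop (@torus_pairing R n) (Lambda_ideal W)) p ->
     has_multiplicity (init_ideal (torus_pairing p) (Lambda_ideal W)) 1).
Proof.
set M := config_matroid W; set I := Lambda_ideal W.
have n_gt0 : (0 < n)%N by have /andP[_] := hdim; exact: leq_ltn_trans.
(* Without bases every element would be a loop, and there is an element since [n] is positive. *)
have nonempty (N : {set {set 'I_n}}) : (forall i, ~ is_loop N i) -> N != finset.set0.
  move=> noloop; apply/negP => /eqP N0; apply: (noloop (Ordinal n_gt0)) => B.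
  by rewrite N0 inE.
have [M0 Md0] := (nonempty _ hloop, nonempty _ hcoloop).
have isoP (p : 'rV[R]_n * 'rV[R]_n) :
    fan_support (@Delta_fan R n M) p <->
    no_isolated_min (orth W) p.1 /\ no_isolated_min [set v | v \in W] (p.1 - p.2).
  rewrite Delta_fan_supportP.
  rewrite (bergman_supportP (@realizes_config _ _ W) M0 hloop).
  by rewrite (bergman_supportP (@realizes_dual_config _ _ W) Md0 hcoloop).
have iso_prime (p : 'rV[R]_n * 'rV[R]_n) : no_isolated_min (orth W) p.1 ->
    no_isolated_min [set v | v \in W] (p.1 - p.2) ->
    is_prime_ideal (init_ideal (torus_pairing p) I).
  by apply: (init_ideal_Lambda_prime (pexp := @decay R)) => //;
     [exact: decayD|exact: decay_neq0|exact: decay_small].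
have trop_iso (p : 'rV[R]_n * 'rV[R]_n) : trop (@torus_pairing R n) I p ->
    no_isolated_min (orth W) p.1 /\ no_isolated_min [set v | v \in W] (p.1 - p.2).
  move=> p_trop; split.
    apply: (trop_no_isolated_min (p := p) (iota := inl)) p_trop => //.
    - by move=> i j [].
    - by move=> a i; exact: subspace_form.
  apply: (trop_no_isolated_min (p := p) (iota := inr)) p_trop => //.
  - by move=> i j [].
  - by move=> v i; exact: incidence_form.
(* Primality of the initial ideal gives weight one, and its properness gives the remaining inclusion
   of supports. *)
split=> [|p [/trop_iso[iso_w iso_gamma] _]]; last exact/prime_ideal_multiplicity/iso_prime.
apply/seteqP; split=> p; first by move=> /trop_iso/isoP.
move=> /isoP[iso_w iso_gamma] Q_full.
by have [_ Q1 _] := iso_prime p iso_w iso_gamma; apply: Q1; rewrite Q_full.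
Qed.
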